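(* Let $I$ be a nonzero square-free monomial ideal in $S=K[x_1,\dots,x_n]$, let $d$ be a positive integer, and let $\Gamma=\mathcal{N}(I)$ be the Stanley-Reisner complex of $I$. Then the following hold over all fields $K$. (a) If $\Gamma$ is $d$-chordal, then $I_{[d+1]}=\mathcal{N}(\Delta_d(\Gamma))$ has a $(d+1)$-linear resolution. (b) If $\Gamma$ is $d$-chordal and $W\subseteq[n]$, then $\mathcal{N}(\Gamma_W)_{[d+1]}$ has a $(d+1)$-linear resolution. (c) If $\Gamma$ is $d$-collapsible, then $I_{[d+1]}=\mathcal{N}(\Delta_d(\Gamma))$ has a $(d+1)$-linear resolution. (d) If $\Gamma$ is $d$-representable, then $I_{[d+1]}=\mathcal{N}(\Delta_d(\Gamma))$ has a $(d+1)$-linear resolution. (e) If $\Gamma$ is chordal, then $I$ is componentwise linear. (f) If $\Gamma$ is $d'$-chordal for all positive integers $d'$ with $t-1\leq d'\leq s-1$, where $t$ and $s$ are, respectively, the smallest and the largest degrees of the minimal monomial generators of $I$, then $I$ is componentwise linear. (g) If $\Gamma$ is $d$-collapsible and $\deg u>d$ for all monomials $u\in I$, then $I$ is componentwise linear. (h) If $\Gamma$ is $d$-representable and $\deg u>d$ for all monomials $u\in I$, then $I$ is componentwise linear. (i) If $\Gamma$ is chordal and $W\subseteq[n]$, then $\mathcal{N}(\Gamma_W)$ is componentwise linear.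
   Context: A simplicial complex on $[n]=\{1,\dots,n\}$ is a set $\Gamma$ of subsets of $[n]$ (faces) closed under taking subsets; the void complex $\emptyset$ is allowed and singletons need not be faces. $\dim F=|F|-1$; facets are maximal faces. For $W\subseteq[n]$, $\Gamma_W=\{F\in\Gamma:F\subseteq W\}$, regarded as a complex on the vertex set $W$. Stanley-Reisner correspondence. For $F\subseteq[n]$, $\mathbf{x}_F=\prod_{i\in F}x_i$. For a simplicial complex $\Gamma$ on a vertex set $V\subseteq [n]$, $\mathcal{N}(\Gamma)=(\mathbf{x}_F: F\subseteq V, F\notin\Gamma)\subseteq K[x_i:i\in V]$; for a square-free monomial ideal $I$ of $S$, $\mathcal{N}(I)=\{F\subseteq[n]:\mathbf{x}_F\notin I\}$. These are mutually inverse. Linearity. For a graded ideal $J$, $\beta_{i,j}(J)=\dim_K\mathrm{Tor}_i(K,J)_j$. $J$ has a $k$-linear resolution if $\beta_{i,j}(J)=0$ for all $i$ and all $j\ne i+k$ (so the zero ideal satisfies this trivially). $J_{\langle j\rangle}$ is the ideal generated by all homogeneous polynomials of degree $j$ in $J$; $J$ is componentwise linear if $J_{\langle j\rangle}$ has a ($j$-)linear resolution for all $j$. For a square-free monomial ideal $J$, $J_{[j]}$ is the ideal generated by all square-free monomials of degree $j$ in $J$. $d$-closure. Let $d\ge1$. $\langle[n]\rangle^{[d-1]}$ denotes the complex of all subsets of $[n]$ with at most $d$ elements. $\Delta_d(\Gamma)$ is the complex on $[n]$ such that: its $d$-dimensional faces are exactly the $d$-dimensional faces of $\Gamma$; all subsets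 of $[n]$ with at most $d$ elements are faces; a subset with more than $d+1$ elements is a face iff all its $(d+1)$-element subsets are faces of $\Gamma$. A complex is a $d$-closure if it equals $\Delta_d(\Sigma)$ for some complex $\Sigma$ on $[n]$. Free and simplicial faces, deletions. A face is free if it is contained in a unique facet (facets are free). A simplicial face of a $d$-closure is a free face of dimension $d-1$. $\Gamma\setminus E=\{F\in\Gamma:E\not\subseteq F\}$; $\Gamma\wr_E=\Gamma$ if $E\notin\Gamma$ and $(\Gamma\setminus E)\cup\{E\}$ if $E\in\Gamma$. Chordality. A simplicial order of a $d$-closure $\Gamma$ is a sequence $E_1,\dots,E_t$ of $(d-1)$-dimensional faces such that, for each $i\ge 1$, $E_i$ is a simplicial face but not a facet of $\Gamma\wr_{E_1}\cdots\wr_{E_{i-1}}$ (which is again a $d$-closure), and $\Gamma\wr_{E_1}\cdots\wr_{E_t}=\langle[n]\rangle^{[d-1]}$. $\Gamma$ is $d$-chordal if $\Delta_d(\Gamma)=\langle[n]\rangle^{[d-1]}$ or $\Delta_d(\Gamma)$ admits a simplicial order; it is chordal if it is $d$-chordal for every $d\ge1$. Collapsibility. If $E$ is a free face of $\Gamma$ with $\dim E<d$, replacing $\Gamma$ by $\Gamma\setminus E$ is an elementary $d$-collapsing. $\Gamma$ is $d$-collapsible if it can be reduced to the void complex $\emptyset$ by finitely many elementary $d$-collapsings. Representability. $\Gamma$ is $d$-representable if there are convex sets $A_1,\dots,A_n\subseteq\mathbb{R}^d$ such that $\Gamma=\{F\subseteq[n]:\bigcap_{i\in F}A_i\ne\emptyset\}$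 (the empty intersection being $\mathbb{R}^d$). *)

(* Defs.v *)
From HB Require Import structures.
From mathcomp Require Import all_boot all_order all_algebra.
From mathcomp Require Import mpoly.
From mathcomp Require Import boolp classical_sets reals convex.

Set Implicit Arguments.
Unset Strict Implicit.
Unset Printing Implicit Defensive.

Import GRing.Theory.

Local Open Scope ring_scope.

(** * Simplicial complexes on the vertex set 'I_n *)

(* A complex is the set of its faces; finset.set0 is the void complex.  Dimensions are
   expressed through cardinalities: dim F = #|F| - 1. *)
Section Complexes.
Variable n : nat.
Implicit Types (G : {set {set 'I_n}}) (E F W : {set 'I_n}) (d : nat).

Definition facet G F : bool := maxset (fun F' => F' \in G) F.

Definition free_face G E : bool :=
  (E \in G) && (#|[set F | facet G F & E \subset F]| == 1)%N.

Definition deletion G E : {set {set 'I_n}} := [set F in G | ~~ (E \subset F)].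

Definition wr_deletion G E : {set {set 'I_n}} :=
  if E \in G then E |: deletion G E else G.

Definition induced G W : {set {set 'I_n}} := [set F in G | F \subset W].

Definition full_skeleton d : {set {set 'I_n}} := [set F : {set 'I_n} | (#|F| <= d)%N].

(* A set F with d + 1 elements has itself as only (d+1)-subset, so the second
   disjunct covers both the faces of dimension d and those of dimension > d. *)
Definition d_closure d G : {set {set 'I_n}} :=
  [set F : {set 'I_n} | (#|F| <= d)%N
    || [forall H : {set 'I_n}, (H \subset F) && (#|H| == d.+1) ==> (H \in G)]].

Definition simplicial_face d G E : bool := free_face G E && (#|E| == d).

Fixpoint simplicial_order d G (Es : seq {set 'I_n}) : Prop :=
  if Es is E :: Es' then
    [/\ simplicial_face d G E, ~~ facet G E
      & simplicial_order d (wr_deletion G E) Es']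
  else G = full_skeleton d.

Definition d_chordal d G : Prop :=
  d_closure d G = full_skeleton d
  \/ exists Es, simplicial_order d (d_closure d G) Es.

Definition chordal G : Prop := forall d, (0 < d)%N -> d_chordal d G.

Inductive d_collapsible d : {set {set 'I_n}} -> Prop :=
| collapsible_void : d_collapsible d finset.set0
| collapsible_step G E :
    free_face G E -> (#|E| <= d)%N -> d_collapsible d (deletion G E) ->
    d_collapsible d G.

Definition d_representable (R : realType) d G : Prop :=
  exists A : 'I_n -> set 'rV[R]_d,
    (forall i, convex_set (A i)) /\
    (forall F, F \in G <-> exists x, forall i, i \in F -> A i x).

End Complexes.

(* A complex whose vertex set is W, transported to 'I_#|W| along the
   enumeration of W; it lets K[x_i : i \in W] be written {mpoly K[#|W|]}. *)
Definition on_vertices n (W : {set 'I_n}) (G : {set {set 'I_n}}) :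
    {set {set 'I_#|W|}} :=
  [set H : {set 'I_#|W|} | [set enum_val i | i in H] \in G].

(** * Monomial ideals *)

Section Ideals.
Variables (K : fieldType) (n : nat).
Notation S := {mpoly K[n]}.
Implicit Types (I J A : set S) (G : {set {set 'I_n}}).

Definition ideal_gen A : set S := fun p =>
  exists2 s : seq (S * S), (forall cg, cg \in s -> A cg.2)
                         & p = \sum_(cg <- s) cg.1 * cg.2.

Definition xmon (F : {set 'I_n}) : S := \prod_(i in F) 'X_i.

Definition squarefree_monomial_ideal I : Prop :=
  exists B : {set {set 'I_n}},
    I = ideal_gen (fun p => exists2 F, F \in B & p = xmon F).

Definition SR_ideal G : set S :=
  ideal_gen (fun p => exists2 F, F \notin G & p = xmon F).

Definition SR_complex I : {set {set 'I_n}} :=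
  [set F : {set 'I_n} | `[< ~ I (xmon F) >]].

Definition squarefree_part J (j : nat) : set S :=
  ideal_gen (fun p => exists F : {set 'I_n}, [/\ #|F| = j, p = xmon F & J p]).

Definition degree_part J (j : nat) : set S :=
  ideal_gen (fun p => J p /\ p \is j.-homog).

Definition minimal_monomial_generator I (m : 'X_{1..n}) : Prop :=
  I 'X_[m] /\ (forall m', (m' <= m)%MM -> I 'X_[m'] -> m' = m).

Definition smallest_generator_degree I (t : nat) : Prop :=
  (exists2 m, minimal_monomial_generator I m & mdeg m = t) /\
  (forall m, minimal_monomial_generator I m -> (t <= mdeg m)%N).

Definition largest_generator_degree I (s : nat) : Prop :=
  (exists2 m, minimal_monomial_generator I m & mdeg m = s) /\
  (forall m, minimal_monomial_generator I m -> (mdeg m <= s)%N).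

(** * Graded Tor and Betti numbers *)

(* p lies in the degree j component of S(-a) *)
Definition shifted_homog (a j : nat) (p : S) : Prop :=
  p = 0 \/ ((a <= j)%N /\ p \is (j - a).-homog).

(* A graded resolution of K = S/(x_1,...,x_n) by free modules of finite rank
     ... -> P_1 -> P_0 -> K -> 0,   P_i = \bigoplus_(k : res_gen i) S(- res_shift k),
   where res_diff i k l is the coefficient, on the generator l of P_i, of the
   image of the generator k of P_(i+1), and res_aug k is the image in K of the
   generator k of P_0; S acts on K through the constant coefficient. *)
Record free_resolution := FreeResolution {
  res_gen : nat -> finType;
  res_shift : forall i, res_gen i -> nat;
  res_diff : forall i, res_gen i.+1 -> res_gen i -> S;
  res_aug : res_gen 0 -> K;
  diff_homog : forall i k l,
    shifted_homog (res_shift l) (res_shift k) (@res_diff i k l);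
  aug_homog : forall k, res_aug k != 0 -> res_shift k = 0%N;
  aug_surj : exists k, res_aug k != 0;
  aug_exact : forall v : {ffun res_gen 0 -> S},
    \sum_k (v k)@_0%MM * res_aug k = 0 <->
    exists u : {ffun res_gen 1 -> S}, v = [ffun l => \sum_k u k * res_diff k l];
  diff_exact : forall i (v : {ffun res_gen i.+1 -> S}),
    [ffun l => \sum_k v k * res_diff k l] = 0 <->
    exists u : {ffun res_gen i.+2 -> S}, v = [ffun l => \sum_k u k * res_diff k l]
}.

(* Since P_i is free, P_i \otimes J is the set of vectors with entries in J. *)
Section Tor.
Variables (P : free_resolution) (J : set S).

Definition boundary i (u : {ffun res_gen P i.+1 -> S}) : {ffun res_gen P i -> S} :=
  [ffun l => \sum_k u k * res_diff k l].

Definition tensor_part i (j : nat) (v : {ffun res_gen P i -> S}) : Prop :=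
  forall k, J (v k) /\ shifted_homog (res_shift k) j (v k).

Definition tor_cycle i (j : nat) : {ffun res_gen P i -> S} -> Prop :=
  match i with
  | 0 => fun v => tensor_part j v
  | i'.+1 => fun v => tensor_part j v /\ boundary v = 0
  end.

Definition tor_boundary i (j : nat) (v : {ffun res_gen P i -> S}) : Prop :=
  exists2 u : {ffun res_gen P i.+1 -> S}, tensor_part j u & v = boundary u.

(* dim_K Tor_i(K, J)_j = b: some b cycles form a K-basis modulo boundaries *)
Definition tor_dim (i j b : nat) : Prop :=
  exists e : 'I_b -> {ffun res_gen P i -> S},
    (forall t, tor_cycle j (e t)) /\
    (forall v, tor_cycle j v -> exists! c : {ffun 'I_b -> K},
       tor_boundary j (v - \sum_t [ffun k => c t *: e t k])).

End Tor.

(* Tor does not depend on the resolution of its first argument. *)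
Definition betti J (i j b : nat) : Prop :=
  exists P : free_resolution, tor_dim P J i j b.

Definition linear_resolution (k : nat) J : Prop :=
  forall i j : nat, j <> (i + k)%N -> betti J i j 0.

Definition componentwise_linear J : Prop :=
  forall j : nat, linear_resolution j (degree_part J j).

End Ideals.

Arguments xmon {K n} F.
Arguments SR_ideal K {n} G.

(* Main.v *)
Require Import Defs.
From HB Require Import structures.
From mathcomp Require Import all_boot all_order all_algebra.
From mathcomp Require Import mpoly.
From mathcomp Require Import boolp classical_sets reals convex.
From mathcomp Require Import lra ring interval_inference.

Set Implicit Arguments.
Unset Strict Implicit.
Unset Printing Implicit Defensive.

Import GRing.Theory.

Local Open Scope ring_scope.

(** Everything reduces to one topological property of a complex G: the reduced cohomology of all
    its induced subcomplexes vanishes from some dimension on, the Leray property.  Cohomology is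
    handled through explicit cochains, graded by the cardinality of faces.

    The Koszul complex resolves K, so Tor of a monomial ideal is the homology of Koszul chains with
    coefficients in the ideal, which splits into multidegrees.  In a multidegree with an exponent at
    least two the piece is a cone where it matters.  In the squarefree multidegree of a vertex set
    W, complementation in W turns it into the cochain complex of the nonfaces contained in W, that
    is, of the simplex on W relative to the induced subcomplex; this is Hochster's formula (exact_monomials,
    nonface_exact_Leray).  Hence the ideal generated in degree j by the squarefree monomials of the
    ideal of G has a j-linear resolution as soon as the complex with the same j-element faces as G,
    filled in as much as possible, is Leray from cardinality j on; here it is called clique j G,
    since it is the clique complex of a graph when j = 2.  Truncating the full monomial ideal in
    degree j leads to the same condition, because the nonfaces generated in size at most j agree
    with the nonfaces of clique j G in the cardinalities that matter.  So componentwise linearity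
    follows from the Leray property of clique j G for all j >= 2; degrees zero and one are elementary.

    It remains to prove the Leray property.  Removing a free face with at most d elements changes no
    cohomology beyond cardinality d: the faces removed with it cancel in pairs by coning at another
    vertex of the facet (acyclic_deletion).  Both elementary collapses and the steps of a
    simplicial order are of this kind, and the end points, the void complex and a skeleton, have no
    large faces.  For the nerve of convex sets in dimension d, replace the sets by polytopes and cut
    by a hyperplane that strictly separates the sets of two facets.  The nerve is the union of the
    nerves of the two halves, which have fewer faces, and by convexity these intersect in the nerve
    of the traces on the hyperplane, of smaller dimension; Mayer-Vietoris concludes (nerve_acyclic).
    Finally a Leray complex has no large minimal nonface, as its proper subsets form a sphere
    (Leray_mem), so that passing from G to clique j G loses nothing. *)

(** * Cohomology of simplicial complexes *)

Section Cochains.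
Import boot.fintype boot.finset.
Variables (K : fieldType) (n : nat).
Implicit Types (x y : 'I_n) (F H W E : {set 'I_n}) (f g h : {set 'I_n} -> K).
Implicit Types (G : {set {set 'I_n}}).

(** The incidence sign counts strictly smaller vertices, so that the same sign serves for removing x
    from F and for adding it. *)
Definition sgn x F : K := (-1) ^+ #|[set y in F | (y < x)%N]|.

Definition cobd f F : K := \sum_(x in F) sgn x F * f (F :\ x).

Definition cone x f F : K := if x \in F then 0 else sgn x F * f (x |: F).

Lemma sgn_sq x F : sgn x F * sgn x F = 1.
Proof. by rewrite /sgn -exprD addnn -mul2n exprM sqrrN expr1n expr1n. Qed.

Lemma sgnD1 x F : sgn x (F :\ x) = sgn x F.
Proof.
rewrite /sgn; congr (_ ^+ _); apply: eq_card => y; rewrite !inE.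
by case: eqP => // ->; rewrite ltnn !andbF.
Qed.

Lemma sgnU1 x F : sgn x (x |: F) = sgn x F.
Proof. by rewrite -sgnD1 -[RHS]sgnD1; congr sgn; apply/setP=> y; rewrite !inE; case: eqP. Qed.

Lemma sgn_gt x y F : (y < x)%N -> sgn y (F :\ x) = sgn y F.
Proof.
move=> ltyx; rewrite /sgn; congr (_ ^+ _); apply: eq_card => z; rewrite !inE.
by case: eqP => // ->; rewrite ltnNge (ltnW ltyx) !andbF.
Qed.

Lemma sgn_lt x y F : x \in F -> (x < y)%N -> sgn y (F :\ x) = - sgn y F.
Proof.
move=> xF ltxy; rewrite /sgn (cardsD1 x [set z in F | (z < y)%N]) inE xF ltxy /=.
rewrite add1n exprS mulN1r opprK; congr (_ ^+ _); apply: eq_card => z.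
by rewrite !inE -andbA.
Qed.

Lemma sgn_anticomm x y F : x \in F -> y \in F -> x != y ->
  sgn x F * sgn y (F :\ x) = - (sgn y F * sgn x (F :\ y)).
Proof.
move=> xF yF; rewrite -val_eqE neq_ltn /= => /orP [] lt.
  by rewrite (sgn_lt xF lt) (sgn_gt _ lt) mulrN mulrC.
by rewrite (sgn_lt yF lt) (sgn_gt _ lt) mulrN mulrC opprK.
Qed.

(** The terms of the double sum cancel in pairs (x, y), (y, x); ordering the
    pairs keeps the argument valid in characteristic two. *)
Lemma cobd_cobd f F : cobd (cobd f) F = 0.
Proof.
pose a x y := sgn x F * (sgn y (F :\ x) * f (F :\ x :\ y)).
have sq : cobd (cobd f) F = \sum_(x in F) \sum_(y in F | y != x) a x y.
  rewrite /cobd; apply: eq_bigr => x xF; rewrite big_distrr /=.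
  by apply: eq_bigl => y; rewrite !inE andbC.
have -> : cobd (cobd f) F =
    \sum_(x in F) \sum_(y in F | (y < x)%N) (a x y + a y x).
  rewrite sq.
  under eq_bigr => x xF do rewrite (bigID (fun y : 'I_n => (y < x)%N)) /=.
  rewrite big_split /=; under [RHS]eq_bigr do rewrite big_split /=.
  rewrite big_split /=; congr (_ + _).
    apply: eq_bigr => x xF; apply: eq_bigl => y; rewrite -andbA; congr (_ && _).
    by rewrite -val_eqE; case: ltngtP.
  rewrite (exchange_big_dep (fun x => x \in F)) /=; last by move=> x y _ /andP[/andP[]].
  apply: eq_bigr => y yF; apply: eq_bigl => x; rewrite yF /=.
  by congr (_ && _); rewrite -val_eqE; case: ltngtP.
apply: big1 => x xF; apply: big1 => y /andP[yF ltyx]; rewrite /a !mulrA.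
have nyx : y != x by rewrite -val_eqE neq_ltn ltyx.
rewrite (sgn_anticomm yF xF nyx).
have -> : F :\ y :\ x = F :\ x :\ y by rewrite !setDDl setUC.
by rewrite mulNr subrr.
Qed.

(** Coning at x contracts the full simplex.  On a subcomplex the same identity applies to a cochain
    extended by zero, provided the last term still vanishes. *)
Lemma cone_homotopy x f F : cobd (cone x f) F + cone x (cobd f) F = f F.
Proof.
rewrite {2}/cone; case: ifPn => xF.
  rewrite addr0 /cobd (bigD1 x) //= big1 => [|y /andP[yF nyx]].
    by rewrite addr0 /cone !inE eqxx /= sgnD1 mulrA sgn_sq mul1r setD1K.
  by rewrite /cone !inE eq_sym nyx xF mulr0.
rewrite {2}/cobd (bigD1 x) ?setU11 //= sgnU1 setU1K // mulrDr mulrA sgn_sq mul1r.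
rewrite addrCA -[RHS]addr0; congr (_ + _); rewrite big_distrr /=.
rewrite (eq_bigl (mem F)) => [|y]; last first.
  by rewrite !inE; case: eqP => [->|_]; rewrite ?(negPf xF) ?andbT ?andbF.
rewrite -big_split big1 //= => y yF.
have nyx : x != y by apply: contraNneq xF => ->.
rewrite /cone !inE (negPf xF) andbF; set F' := x |: F.
have -> : x |: F :\ y = F' :\ y.
  by apply/setP=> z; rewrite !inE; case: eqP => //= ->; rewrite nyx.
have e1 : sgn y F = sgn y (F' :\ x) by rewrite /F' setU1K.
have e2 : sgn x (F :\ y) = sgn x (F' :\ y).
  rewrite -[RHS]sgnD1 -[LHS]sgnD1; congr sgn; apply/setP=> z; rewrite !inE.
  by case: eqP.
have xF' : x \in F' by rewrite setU11.
have yF' : y \in F' by rewrite inE yF orbT.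
rewrite e1 e2 -(sgnU1 x F) -/F' !mulrA -mulrDl.
suff -> : sgn y (F' :\ x) * sgn x (F' :\ y) = - (sgn x F' * sgn y F').
  by rewrite addNr mul0r.
have := sgn_anticomm xF' yF' nyx => /(congr1 (fun t => sgn x F' * t * sgn x (F' :\ y))).
rewrite !mulrA sgn_sq mul1r => ->.
by rewrite mulrN mulNr -!mulrA sgn_sq mulr1.
Qed.

Lemma cobdB f g F : cobd (fun H => f H - g H) F = cobd f F - cobd g F.
Proof. by rewrite /cobd -sumrB; apply: eq_bigr => x _; rewrite mulrBr. Qed.

Lemma cobdD f g F : cobd (fun H => f H + g H) F = cobd f F + cobd g F.
Proof. by rewrite /cobd -big_split; apply: eq_bigr => x _; rewrite mulrDr. Qed.

Lemma eq_cobd f g F c : #|F| = c.+1 ->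
  (forall H, H \subset F -> #|H| = c -> f H = g H) -> cobd f F = cobd g F.
Proof.
move=> cF fg; apply: eq_bigr => x xF; congr (_ * _); apply: fg.
  exact: subD1set.
by apply/eqP; rewrite -eqSS -cF (cardsD1 x F) xF.
Qed.

(** Vanishing of the reduced cohomology of G in dimension c - 1.  Cochains are functions on all
    sets, of which only the values on faces of the relevant size count; a value off G is
    harmless since G is closed under subsets in all uses. *)
Definition acyclic_at G c := forall f,
  (forall F, F \in G -> #|F| = c.+1 -> cobd f F = 0) ->
  exists g, forall F, F \in G -> #|F| = c -> f F = cobd g F.

(** With j = d + 1 this is the property of being d-Leray. *)
Definition Leray j G := forall W c, (j <= c)%N -> acyclic_at (induced G W) c.

Definition down_closed G := forall F H, F \in G -> H \subset F -> H \in G.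

Lemma eq_acyclic G G' c :
  (forall F, (c <= #|F|)%N -> (F \in G) = (F \in G')) ->
  acyclic_at G c -> acyclic_at G' c.
Proof.
move=> eG acG f fP; have [|g gP] := acG f.
  by move=> F FG cF; apply: fP; rewrite -?eG // cF.
by exists g => F FG cF; apply: gP => //; rewrite eG // cF.
Qed.

Lemma eq_Leray G G' j :
  (forall F, (j <= #|F|)%N -> (F \in G) = (F \in G')) -> Leray j G -> Leray j G'.
Proof.
move=> eG LG W c jc; apply: eq_acyclic (LG W c jc) => F cF.
by rewrite !inE eG // (leq_trans jc).
Qed.

Lemma acyclic_empty G c : (forall F, F \in G -> #|F| <> c) -> acyclic_at G c.
Proof. by move=> G0 f _; exists f => F /G0. Qed.

Lemma induced_down_closed G W : down_closed G -> down_closed (induced G W).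
Proof.
move=> dG F H; rewrite !inE => /andP[FG FW] HF.
by rewrite (dG F) //= (subset_trans HF).
Qed.

(** A simplex is a cone, except that the empty simplex has cohomology in
    cardinality zero. *)
Lemma acyclic_simplex (A : {set 'I_n}) c : (0 < c)%N ->
  acyclic_at [set F : {set 'I_n} | F \subset A] c.
Proof.
move=> c0; have [->|[x xA]] := set_0Vmem A.
  apply: acyclic_empty => F; rewrite inE subset0 => /eqP ->.
  by rewrite cards0 => e; rewrite -e in c0.
move=> f fP; exists (cone x f) => F; rewrite inE => FA cF.
rewrite -[LHS](cone_homotopy x) /cone; case: ifPn => xF; first by rewrite addr0.
rewrite fP ?mulr0 ?addr0 //; first by rewrite inE subUset sub1set xA.
by rewrite cardsU1 xF cF.
Qed.

Lemma Leray_simplex (A : {set 'I_n}) j : (0 < j)%N -> Leray j [set F : {set 'I_n} | F \subset A].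
Proof.
move=> j0 W c jc.
have -> : induced [set F : {set 'I_n} | F \subset A] W = [set F : {set 'I_n} | F \subset A :&: W].
  by apply/setP=> F; rewrite !inE subsetI.
by apply: acyclic_simplex; apply: leq_trans jc.
Qed.

Lemma facet_above G F : F \in G -> exists2 H, facet G H & F \subset H.
Proof. by move=> FG; have [H mH FH] := maxset_exists (P := fun F' => F' \in G) FG; exists H. Qed.

Lemma facetP G F : reflect (F \in G /\ forall H, H \in G -> F \subset H -> H = F) (facet G F).
Proof. exact: maxsetP. Qed.

Lemma free_faceP G E : free_face G E ->
  E \in G /\ exists2 M, facet G M & E \subset M /\ forall H, H \in G -> E \subset H -> H \subset M.
Proof.
move=> /andP[EG /cards1P[M eM]]; split=> //.
have: M \in [set F | facet G F & E \subset F] by rewrite eM set11.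
rewrite inE => /andP[fM EM]; exists M => //; split=> // H HG EH.
have [N fN HN] := facet_above HG.
have: N \in [set F | facet G F & E \subset F] by rewrite inE fN (subset_trans EH).
by rewrite eM inE => /eqP <-.
Qed.

(** Removing a free face E changes no cohomology above the cardinality of E: the
    faces strictly containing E all lie in one facet, hence cancel in pairs by coning at
    a vertex of that facet outside E. *)
Lemma acyclic_deletion G E W c : down_closed G -> free_face G E -> (#|E| < c)%N ->
  acyclic_at (induced (deletion G E) W) c -> acyclic_at (induced G W) c.
Proof.
move=> dG /free_faceP [EG [M /facetP[MG _] [EM EMax]]] Ec acD f fP.
have [|g gP] := acD f.
  by move=> F; rewrite !inE => /andP[/andP[FG _] FW]; apply: fP; rewrite inE FG.
pose z F := f F - cobd g F.
have zD F : F \in induced G W -> #|F| = c -> ~~ (E \subset F) -> z F = 0.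
  rewrite !inE => /andP[FG FW] cF EF; rewrite /z gP ?subrr // !inE FG EF //.
have zc F : F \in induced G W -> #|F| = c.+1 -> cobd z F = 0.
  by move=> FG cF; rewrite cobdB cobd_cobd subr0 fP.
pose z' F := if E \subset F then z F else 0.
have zz' F : F \in induced G W -> #|F| = c -> z F = z' F.
  by move=> FG cF; rewrite /z'; case: ifPn => // /(zD _ FG cF).
have dW := induced_down_closed (W := W) dG.
suff [h hP] : exists h, forall F, F \in induced G W -> #|F| = c -> z F = cobd h F.
  exists (fun F => g F + h F) => F FG cF; rewrite cobdD -hP //.
  by rewrite /z addrCA subrr addr0.
(* without a vertex of M outside E in W, no face in W strictly contains E *)
have [MWE|[x]] := set_0Vmem ((M :&: W) :\: E).
  exists (fun _ => 0) => F FG cF.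
  rewrite zD //; last first.
    apply/negP => EF; move: (FG); rewrite inE => /andP[FG' FW].
    have FM := EMax _ FG' EF.
    suff FE : F \subset E by have := subset_leq_card FE; rewrite cF leqNgt Ec.
    by rewrite -setD_eq0 -subset0 -MWE setSD // subsetI FM.
  by rewrite /cobd big1 // => x _; rewrite mulr0.
rewrite !inE => /andP[xE /andP[xM xW]]; exists (cone x z') => F FG cF.
rewrite zz' // -[LHS](cone_homotopy x) {2}/cone; case: ifPn => xF; first by rewrite addr0.
suff -> : cobd z' (x |: F) = 0 by rewrite mulr0 addr0.
have cF' : #|x |: F| = c.+1 by rewrite cardsU1 xF cF.
have EF' : (E \subset x |: F) = (E \subset F).
  apply/idP/idP => [/subsetP EF|]; last by move/subset_trans; apply; exact: subsetUr.
  by apply/subsetP => y yE; have := EF _ yE; rewrite !inE => /orP[/eqP e|//]; rewrite -e yE in xE.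
have [EF|EF] := boolP (E \subset F).
  move: (FG); rewrite inE => /andP[FG' FW].
  have F'G : x |: F \in induced G W.
    rewrite inE subUset sub1set xW FW (dG M) // subUset sub1set xM.
    exact: EMax.
  rewrite -(zc _ F'G cF'); apply: (eq_cobd cF') => H HF' cH.
  by rewrite -zz' // (dW _ _ F'G).
rewrite /cobd big1 // => y _; rewrite /z' ifN ?mulr0 //.
apply: contra EF; rewrite -EF'; move/subset_trans; apply; exact: subD1set.
Qed.

Lemma deletion_down_closed G E : down_closed G -> down_closed (deletion G E).
Proof.
move=> dG F H; rewrite !inE => /andP[FG EF] HF; rewrite (dG F) //=.
by apply: contra EF => /subset_trans; apply.
Qed.

Lemma wr_deletion_down_closed G E : down_closed G -> down_closed (wr_deletion G E).
Proof.
move=> dG; rewrite /wr_deletion; case: ifP => // EG F H; rewrite !inE.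
case: (eqVneq H E) => //= nHE; case: (eqVneq F E) => /= [-> _ HE|nFE].
  by rewrite (dG E) //; apply: contra nHE; rewrite eqEsubset HE.
move=> /andP[FG EF] HF; rewrite (dG F) //=.
by apply: contra EF => /subset_trans; apply.
Qed.

(** A step of the order differs from the deletion of E by E itself, whose cardinality is below the
    range of the Leray property. *)
Lemma Leray_simplicial_order d Es G : down_closed G ->
  simplicial_order d G Es -> Leray d.+1 G.
Proof.
elim: Es G => [|E Es IH] G dG /=.
  move=> -> W c dc; apply: acyclic_empty => F; rewrite !inE => /andP[Fd _] cF.
  by rewrite cF leqNgt dc in Fd.
move=> [/andP[fE /eqP cE] _ /IH]; have := wr_deletion_down_closed (E := E) dG.
move=> /[swap] /[apply] LW W c dc.
apply: (acyclic_deletion dG fE); first by rewrite cE.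
apply: eq_acyclic (LW W c dc) => F cF; rewrite !inE; congr (_ && _).
have [EG _] := free_faceP fE; rewrite /wr_deletion EG !inE.
by case: eqVneq => [e|//]; move: cF; rewrite e cE leqNgt dc.
Qed.

Lemma Leray_collapsible d G : down_closed G -> d_collapsible d G -> Leray d.+1 G.
Proof.
move=> dG cG; elim: cG dG => [_ W c _|{}G E fE Ed _ IH dG W c dc].
  by apply: acyclic_empty => F; rewrite !inE.
apply: (acyclic_deletion dG fE); first exact: leq_ltn_trans Ed dc.
exact: IH (deletion_down_closed dG) _ _ dc.
Qed.

(** For j = 2 the clique complex of a graph, for j = d + 1 the d-closure; the value j = 1 gives a
    simplex. *)
Definition clique j G : {set {set 'I_n}} :=
  [set F : {set 'I_n} | [forall H : {set 'I_n}, (H \subset F) && (#|H| == j) ==> (H \in G)]].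

Lemma in_clique j G F :
  reflect (forall H, H \subset F -> #|H| = j -> H \in G) (F \in clique j G).
Proof.
rewrite inE; apply: (iffP forallP) => [h H HF /eqP cH|h H].
  by have := h H; rewrite HF cH.
by apply/implyP => /andP[HF /eqP]; apply: h.
Qed.

Lemma d_closure_clique d G : d_closure d G = clique d.+1 G.
Proof.
apply/setP=> F; rewrite !inE; case: leqP => //= Fd.
by symmetry; apply/forallP=> H; apply/implyP=> /andP[/subset_leq_card HF /eqP cH];
  rewrite cH ltnNge Fd in HF.
Qed.

Lemma clique_down_closed j G : down_closed (clique j G).
Proof.
move=> F H /in_clique FG HF; apply/in_clique => H' H'H; apply: FG; exact: subset_trans HF.
Qed.

Lemma Leray_chordal d G : d_chordal d G -> Leray d.+1 (clique d.+1 G).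
Proof.
have dG := clique_down_closed (j := d.+1) (G := G).
rewrite -d_closure_clique in dG *; case=> [e|[Es]]; last exact: Leray_simplicial_order.
exact: (@Leray_simplicial_order d [::]).
Qed.

(** The proper subsets of a minimal nonface form a sphere: on them every cochain of top
    cardinality is a cocycle, but the indicator of one of them is no coboundary, since its
    coboundary at F is a sign instead of zero. *)
Lemma Leray_mem j G F : (0 < j)%N -> down_closed G -> Leray j G ->
  F \in clique j G -> (j <= #|F|)%N -> F \in G.
Proof.
move=> j0 dG LG; have [m] := ubnP #|F|; elim: m F => // m IH F Fm /in_clique FG.
rewrite leq_eqVlt => /orP[/eqP e|jF]; first exact: FG.
have sub H : H \proper F -> (j <= #|H|)%N -> H \in G.
  move=> HF; apply: IH; first by apply: leq_trans (proper_card HF) _.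
  by apply: (clique_down_closed _ (proper_sub HF)); apply/in_clique.
apply: contraT => nFG.
have [x xF] : exists x, x \in F.
  by apply/set0Pn; rewrite -card_gt0; apply: leq_ltn_trans jF.
have cF : #|F| = #|F|.-1.+1 by rewrite prednK //; apply: leq_ltn_trans jF.
have jc : (j <= #|F|.-1)%N by rewrite -ltnS -cF.
pose f H : K := (H == F :\ x)%:R.
have [|g gP] := LG F _ jc f.
  move=> H; rewrite inE => /andP[HG HF]; rewrite -cF => cH.
  suff e : H = F by rewrite e (negPf nFG) in HG.
  by apply/eqP; rewrite eqEcard HF cH /=.
have fg H : H \subset F -> #|H| = #|F|.-1 -> f H = cobd g H.
  move=> HF cH; apply: gP => //; rewrite inE HF andbT sub ?cH //.
  by rewrite properEcard HF cH ltn_predL; apply: leq_ltn_trans jF.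
have: cobd f F = 0 by rewrite (eq_cobd cF fg) cobd_cobd.
rewrite /cobd (bigD1 x) //= big1 => [|y /andP[yF nyx]]; last first.
  rewrite /f; case: eqP => [e|_]; last by rewrite mulr0.
  have : y \in F :\ x by rewrite !inE nyx.
  by rewrite -e !inE eqxx.
rewrite /f eqxx mulr1 addr0 => s0; have := sgn_sq x F.
by rewrite s0 mul0r => /eqP; rewrite eq_sym oner_eq0.
Qed.

Lemma Leray_clique j G : (0 < j)%N -> down_closed G -> Leray j G -> Leray j (clique j G).
Proof.
move=> j0 dG LG; apply: (eq_Leray _ LG) => F jF; apply/idP/idP => [FG|FG].
  by apply/in_clique => H HF _; apply: dG HF.
exact: Leray_mem LG FG jF.
Qed.


(** Mayer-Vietoris: the cochains bounding a cocycle on the two pieces differ on the intersection by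
    a cocycle, and correcting one of them by a cochain bounding it allows to glue them. *)
Lemma acyclic_setU G1 G2 c : down_closed G1 -> down_closed G2 ->
  acyclic_at G1 c.+1 -> acyclic_at G2 c.+1 -> acyclic_at (G1 :&: G2) c ->
  acyclic_at (G1 :|: G2) c.+1.
Proof.
move=> d1 d2 ac1 ac2 ac12 f fP.
have [|g1 g1P] := ac1 f; first by move=> F F1; apply: fP; rewrite inE F1.
have [|g2 g2P] := ac2 f; first by move=> F F2; apply: fP; rewrite inE F2 orbT.
have [|w wP] := ac12 (fun F => g1 F - g2 F).
  move=> F; rewrite inE => /andP[F1 F2] cF.
  by rewrite cobdB -g1P // -g2P // subrr.
pose w' F := if F \in G1 then g1 F - cobd w F else g2 F.
exists w' => F; rewrite inE; have [F1 _ cF|F1 /= F2 cF] := boolP (F \in G1).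
  rewrite (@eq_cobd _ (fun H => g1 H - cobd w H) _ _ cF) => [|H HF _].
    by rewrite cobdB cobd_cobd subr0 g1P.
  by rewrite /w' (d1 F).
rewrite (eq_cobd (g := g2) cF) => [|H HF cH]; first exact: g2P.
rewrite /w'; case: ifPn => // H1.
have H12 : H \in G1 :&: G2 by rewrite inE H1 (d2 F).
by rewrite -(wP _ H12 cH) subKr.
Qed.

End Cochains.

(** A monotone relabelling preserves the signs, so cohomology conditions are inherited by
    subcomplexes on fewer vertices. *)
Section Relabelling.
Import boot.fintype boot.finset.
Variables (K : fieldType) (m n : nat) (phi : 'I_m -> 'I_n).
Hypothesis phi_mono : {mono phi : x y / (x < y)%N}.

Lemma relabel_inj : injective phi.
Proof.
move=> x y e; apply: val_inj.
by case: (ltngtP x y) => //; rewrite -phi_mono e ltnn.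
Qed.

Lemma cobd_relabel (f : {set 'I_n} -> K) (F : {set 'I_m}) :
  cobd f (phi @: F) = cobd (fun H : {set 'I_m} => f (phi @: H)) F.
Proof.
have pI := relabel_inj.
rewrite /cobd big_imset /=; last by move=> x y _ _ /pI.
apply: eq_bigr => x xF; congr (_ * f _).
  rewrite /sgn -(card_imset _ pI); congr (_ ^+ _); apply: eq_card => y.
  rewrite inE; apply/andP/imsetP => [[/imsetP[z zF ->]]|[z]].
    by rewrite phi_mono => zx; exists z => //; rewrite inE zF.
  by rewrite inE => /andP[zF zx] ->; rewrite phi_mono imset_f.
apply/setP=> y; rewrite !inE; apply/andP/imsetP => [[nyx /imsetP[z zF e]]|[z]].
  by exists z => //; rewrite !inE zF andbT; apply: contraNneq nyx => <-; rewrite e.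
by rewrite !inE => /andP[nzx zF] ->; rewrite (inj_eq pI) nzx imset_f.
Qed.

Lemma Leray_relabel j (G : {set {set 'I_n}}) :
  Leray K j G -> Leray K j [set H : {set 'I_m} | phi @: H \in G].
Proof.
have pI := relabel_inj.
move=> LG W c jc f fP.
have pre (F : {set 'I_m}) : phi @^-1: (phi @: F) = F.
  by apply/setP=> x; rewrite inE mem_imset.
have [|g gP] := LG (phi @: W) c jc (fun F => f (phi @^-1: F)).
  move=> F; rewrite inE => /andP[FG FW] cF.
  have eF : F = phi @: (phi @^-1: F).
    apply/setP=> y; apply/idP/imsetP => [yF|[x]]; last by rewrite inE => ? ->.
    have /imsetP[x xW e] := subsetP FW _ yF.
    by exists x => //; rewrite inE -e.
  rewrite eF cobd_relabel; under eq_fun do rewrite pre.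
  rewrite fP //; last by rewrite -cF {2}eF card_imset.
  rewrite !inE -eF FG /=; apply/subsetP => x; rewrite inE => /(subsetP FW) /imsetP[y yW /pI].
  by move=> ->.
exists (fun H : {set 'I_m} => g (phi @: H)) => F; rewrite !inE => /andP[FG FW] cF.
have := gP (phi @: F); rewrite inE FG imsetS // card_imset // => /(_ isT cF).
by rewrite pre => ->; rewrite cobd_relabel.
Qed.

End Relabelling.

(** * Nerves of convex sets *)

Section Gordan.
Import Order.TTheory Num.Theory.
Variables (R : realFieldType).

Section Dot.
Variables (p q : nat).
Implicit Types (u v w : 'M[R]_(p, q)).

Definition dot u v : R := \sum_i \sum_j u i j * v i j.

Lemma dotDl u v w : dot (u + v) w = dot u w + dot v w.
Proof.
rewrite /dot -big_split; apply: eq_bigr => i _; rewrite -big_split.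
by apply: eq_bigr => j _; rewrite mxE mulrDl.
Qed.

Lemma dotC u v : dot u v = dot v u.
Proof. by apply: eq_bigr => i _; apply: eq_bigr => j _; rewrite mulrC. Qed.

Lemma dotDr u v w : dot u (v + w) = dot u v + dot u w.
Proof. by rewrite dotC dotDl !(dotC u). Qed.

Lemma dotZl a u v : dot (a *: u) v = a * dot u v.
Proof.
rewrite /dot big_distrr /=; apply: eq_bigr => i _; rewrite big_distrr /=.
by apply: eq_bigr => j _; rewrite mxE mulrA.
Qed.

Lemma dotZr a u v : dot u (a *: v) = a * dot u v.
Proof. by rewrite dotC dotZl dotC. Qed.

Lemma dotNl u v : dot (- u) v = - dot u v.
Proof. by rewrite -scaleN1r dotZl mulN1r. Qed.

Lemma dotNr u v : dot u (- v) = - dot u v.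
Proof. by rewrite dotC dotNl dotC. Qed.

Lemma dot0l v : dot 0 v = 0.
Proof. by rewrite -(scale0r 0) dotZl mul0r. Qed.

Lemma dot_suml (I : Type) (r : seq I) (P : pred I) (F : I -> 'M_(p, q)) v :
  dot (\sum_(i <- r | P i) F i) v = \sum_(i <- r | P i) dot (F i) v.
Proof. by elim/big_ind2: _ => [|x1 x2 y1 y2 <- <-|//]; rewrite ?dot0l ?dotDl. Qed.

Lemma dot_gt0 w : w != 0 -> 0 < dot w w.
Proof.
have ge0 i : 0 <= \sum_j w i j * w i j by apply: sumr_ge0 => j _; rewrite -expr2 sqr_ge0.
move=> w0; rewrite lt_def sumr_ge0 ?andbT => [|i _]; last exact: ge0.
apply: contra w0 => /eqP w0; apply/eqP/matrixP => i j; rewrite mxE.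
have /eqP := psumr_eq0P (fun i _ => ge0 i) w0 (i := i) isT.
rewrite psumr_eq0 => [/allP/(_ j)|k _]; last by rewrite -expr2 sqr_ge0.
by rewrite mem_index_enum -expr2 sqrf_eq0 => /(_ isT) /eqP.
Qed.

End Dot.

(** Strict inequalities in finite number survive small perturbations. *)
Lemma perturb (T : eqType) (s : seq T) (a b : T -> R) :
  (forall v, v \in s -> 0 < a v) ->
  exists2 e, 0 < e & forall e', 0 < e' -> e' <= e -> forall v, v \in s -> 0 < a v + e' * b v.
Proof.
elim: s => [|v s IH] sP; first by exists 1.
have [|e e0 eP] := IH; first by move=> w ws; apply: sP; rewrite inE ws orbT.
have av : 0 < a v by apply: sP; rewrite mem_head.
have B0 : 0 < 1 + `|b v| by rewrite ltr_pwDl.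
exists (Num.min e (a v / (1 + `|b v|))); first by rewrite lt_min e0 divr_gt0.
move=> e' e'0; rewrite le_min => /andP[e'e]; rewrite ler_pdivlMr // => e'a w.
rewrite inE => /orP[/eqP ->|ws]; last exact: eP.
have nb : - `|b v| <= b v by rewrite lerNl -normrN ler_norm.
have := ler_wpM2l (ltW e'0) nb; rewrite mulrN => h.
have := e'a; rewrite mulrDr mulr1; lra.
Qed.

(** Gordan's alternative, by induction on s: if the form found for the other vectors is negative on
    the new vector w, project them along w; if it vanishes on w, tilt it slightly towards w.  Stating
    the second case for every set closed under sums and positive multiples spares coefficients. *)
Lemma gordan p q (s : seq 'M[R]_(p, q)) :
  (exists u, forall v, v \in s -> 0 < dot u v) \/
  (forall C : 'M[R]_(p, q) -> Prop,
     (forall x y, C x -> C y -> C (x + y)) -> (forall (t : R) x, 0 < t -> C x -> C (t *: x)) ->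
     (forall v, v \in s -> C v) -> C 0).
Proof.
have [m] := ubnP (size s); elim: m s => // m IH [_|w s /=]; first by left; exists 0.
rewrite ltnS => sm; have [[f fP]|C0] := IH s sm; last first.
  right=> C CD CZ Cs; apply: C0 => // v vs; apply: Cs; rewrite inE vs orbT.
  by [].
have [fw|fw|fw] := ltgtP (dot f w) 0; last 2 first.
- by left; exists f => v; rewrite inE => /orP[/eqP ->|/fP].
- have [->|w0] := eqVneq w 0.
    by right=> C _ _; apply; rewrite mem_head.
  have [e e0 eP] := perturb (dot w) fP.
  left; exists (f + e *: w) => v; rewrite inE dotDl dotZl => /orP[/eqP ->|vs].
    by rewrite fw add0r mulr_gt0 // dot_gt0.
  exact: eP.
(* project along w onto the hyperplane f = 0; t v > 0 keeps the cone *)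
pose t v := - (dot f v / dot f w).
have t0 v : v \in s -> 0 < t v.
  by move=> vs; rewrite /t -mulrN -invrN divr_gt0 ?fP // oppr_gt0.
have ft v : dot f (v + t v *: w) = 0.
  by rewrite dotDr dotZr /t mulNr divfK ?subrr // lt_eqF.
have [||C0] := IH [seq v + t v *: w | v <- s]; first by rewrite size_map.
  move=> [g gP].
  have [|e e0 eP] := @perturb _ s (fun v => dot g (v + t v *: w)) (fun v => - t v).
    by move=> v vs; apply: gP; apply: map_f.
  left; pose r := (e - dot g w) / dot f w.
  have hw : dot (g + r *: f) w = e.
    by rewrite dotDl dotZl /r divfK ?lt_eqF // addrC subrK.
  exists (g + r *: f) => v; rewrite inE => /orP[/eqP ->|vs]; first by rewrite hw.
  have := eP e e0 (lexx e) v vs; congr (_ < _).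
  have -> : dot g (v + t v *: w) = dot (g + r *: f) (v + t v *: w).
    by rewrite dotDl dotZl ft mulr0 addr0.
  by rewrite dotDr dotZr hw mulrN [e * _]mulrC addrK.
right=> C CD CZ Cs; apply: C0 => // x /mapP[v vs ->].
by apply: CD; [|apply: CZ; [exact: t0|]]; apply: Cs; rewrite inE ?eqxx ?vs ?orbT.
Qed.

End Gordan.

Section Nerve.
Import Order.TTheory Num.Theory.
Import boot.fintype boot.finset.
Variables (R : realFieldType) (n : nat).
Implicit Types (F H M : {set 'I_n}).

Definition convex_pred d (A : 'rV[R]_d -> Prop) :=
  forall x y (s t : R), A x -> A y -> 0 <= s -> 0 <= t -> s + t = 1 -> A (s *: x + t *: y).

Definition nerve d (A : 'I_n -> 'rV[R]_d -> Prop) : {set {set 'I_n}} :=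
  [set F : {set 'I_n} | `[< exists x, forall i, i \in F -> A i x >]].

Lemma in_nerve d (A : 'I_n -> 'rV[R]_d -> Prop) F :
  reflect (exists x, forall i, i \in F -> A i x) (F \in nerve A).
Proof. rewrite inE; exact: asboolP. Qed.

Lemma nerve_down_closed d (A : 'I_n -> 'rV[R]_d -> Prop) : down_closed (nerve A).
Proof.
move=> F H /in_nerve[x xF] HF; apply/in_nerve; exists x => i iH.
by apply: xF; apply: (subsetP HF).
Qed.

Lemma convex_halfspace d (w : 'rV[R]_d) a : convex_pred (fun x => a <= dot w x).
Proof.
move=> x y s t ax ay s0 t0 st; rewrite dotDr !dotZr.
have := ler_wpM2l s0 ax; have := ler_wpM2l t0 ay.
have -> : a = s * a + t * a by rewrite -mulrDl st mul1r.
move=> h1 h2; rewrite -mulrDl st mul1r in h1 h2 *.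
have : s * a + t * a = a by rewrite -mulrDl st mul1r.
lra.
Qed.

Lemma convexN_halfspace d (w : 'rV[R]_d) a : convex_pred (fun x => dot w x <= a).
Proof.
move=> x y s t ax ay s0 t0 st; rewrite -lerN2 -dotNl.
by apply: convex_halfspace => //; rewrite dotNl lerN2.
Qed.

Lemma convexI d (A B : 'rV[R]_d -> Prop) :
  convex_pred A -> convex_pred B -> convex_pred (fun x => A x /\ B x).
Proof. by move=> cA cB x y s t [Ax Bx] [Ay By] *; split; [apply: cA|apply: cB]. Qed.

Section Hull.
Variables (d : nat) (G : {set {set 'I_n}}) (p : {set 'I_n} -> 'rV[R]_d).

(** The convex hull of the points p F over the faces F containing i, defined by its universal
    property to avoid coefficients.  Being a polytope, it can be separated strictly. *)
Definition hull i x := forall C, convex_pred C ->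
  (forall F, F \in G -> i \in F -> C (p F)) -> C x.

Lemma hull_convex i : convex_pred (hull i).
Proof.
move=> x y s t hx hy s0 t0 st C cC CP; by apply: (cC x y s t) => //; [apply: hx|apply: hy].
Qed.

Lemma hull_pt i F : F \in G -> i \in F -> hull i (p F).
Proof. by move=> FG iF C _; apply. Qed.

(** Apply Gordan's alternative to the tuples of vertices of the hulls, modulo the diagonal: the
    origin lies in their cone only if the hulls meet.  A form on tuples that vanishes on the
    diagonal is a family of forms with sum zero. *)
Lemma hulls_separation (F : {set 'I_n}) : F != set0 ->
  ~ (exists x, forall i, i \in F -> hull i x) ->
  exists w : 'I_n -> 'rV[R]_d, \sum_(i in F) w i = 0 /\
    forall q : 'I_n -> {set 'I_n}, (forall i, i \in F -> q i \in G /\ i \in q i) ->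
      0 < \sum_(i in F) dot (w i) (p (q i)).
Proof.
move=> /set0Pn[i0 i0F] disj.
pose V (x : 'I_n -> 'rV[R]_d) : 'M[R]_(n, d) :=
  \matrix_i (if i \in F then x i - x i0 else 0).
pose ok (q : {ffun 'I_n -> {set 'I_n}}) := [forall i, (i \in F) ==> (q i \in G) && (i \in q i)].
pose s := [seq V (fun i => p (q i)) | q : {ffun 'I_n -> {set 'I_n}} <- enum ok].
have [[u uP]|C0] := gordan s; last first.
  exfalso; apply: disj.
  (* the cone over the tuples of points of the hulls *)
  pose C (y : 'M[R]_(n, d)) := exists (t : R) (x : 'I_n -> 'rV[R]_d), [/\ 0 < t,
    forall i, i \in F -> hull i (x i) & y = t *: V x].
  have [|t y t0 [r [x [r0 xP ->]]]|v|t [x [t0 xP /esym/eqP]]] := C0 C.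
  - move=> _ _ [t [x [t0 xP ->]]] [r [y [r0 yP ->]]].
    have tr : 0 < t + r by rewrite addr_gt0.
    exists (t + r), (fun i => (t / (t + r)) *: x i + (r / (t + r)) *: y i); split=> // [i iF|].
      apply: hull_convex; rewrite ?divr_ge0 ?ltW //; [exact: xP|exact: yP|].
      by rewrite -mulrDl divff // gt_eqF.
    apply/row_matrixP => i; rewrite linearD !linearZ /= !rowK.
    case: ifP => _; last by rewrite !scaler0 addr0.
    rewrite opprD addrACA -!scalerBr [RHS]scalerDr !scalerA.
    by rewrite ![(t + r) * _]mulrC !divfK // gt_eqF.
  - by exists (t * r), x; split; [apply: mulr_gt0|exact: xP|rewrite scalerA].
  - move=> /mapP[q]; rewrite mem_enum => /forallP qok ->.
    exists 1, (fun i => p (q i)); rewrite ltr01 scale1r; split=> // i iF.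
    by have := qok i; rewrite iF => /andP[qG iq]; apply: hull_pt.
  rewrite scaler_eq0 gt_eqF //= => /eqP V0; exists (x i0) => i iF.
  have := congr1 (row i) V0; rewrite rowK iF row0 => /eqP.
  by rewrite subr_eq0 => /eqP <-; apply: xP.
pose sumu := \sum_(j in F) row j u.
(* V subtracts the coordinate i0; charge it with minus the sum of the others *)
pose w i := row i u - (if i == i0 then sumu else 0).
exists w; split.
  rewrite sumrB -/sumu; apply/eqP; rewrite subr_eq0 eq_sym; apply/eqP.
  by rewrite (bigD1 i0) //= eqxx big1 ?addr0 // => i /andP[_ /negPf ->].
move=> q qP.
have /uP : V (fun i => p (q i)) \in s.
  apply/mapP; exists [ffun i => q i].
    rewrite mem_enum; apply/forallP => i; apply/implyP => /qP[qG iq].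
    by rewrite ffunE qG.
  by apply/row_matrixP => i; rewrite !rowK !ffunE.
congr (0 < _).
have -> : dot u (V (fun i => p (q i))) =
    \sum_(i in F) dot (row i u) (p (q i) - p (q i0)).
  rewrite [RHS]big_mkcond; apply: eq_bigr => i _.
  under eq_bigr => j _ do rewrite mxE.
  case: ifP => _; last by apply: big1 => j _; rewrite mxE mulr0.
  by rewrite /dot big_ord1; apply: eq_bigr => j _; rewrite !mxE.
under eq_bigr => i _ do rewrite dotDr dotNr.
under [RHS]eq_bigr => i _ do rewrite dotDl dotNl.
rewrite !sumrB -dot_suml -/sumu; congr (_ - _).
rewrite [RHS](bigD1 i0) //= eqxx big1 ?addr0 // => i /andP[_ /negPf ->].
by rewrite dot0l.
Qed.

(** Summing the forms over F1, and over the rest of F2, gives opposite forms; each is bounded below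
    by its values at the vertices, and the two bounds have a positive sum. *)
Lemma facets_separation F1 F2 : F1 \in G -> F2 \in G -> F1 :|: F2 != set0 ->
  ~ (exists x, forall i, i \in F1 :|: F2 -> hull i x) ->
  exists f c, (forall x, (forall i, i \in F1 -> hull i x) -> c < dot f x) /\
              (forall x, (forall i, i \in F2 -> hull i x) -> dot f x < c).
Proof.
move=> G1 G2 F0 disj; have [w [w0 wP]] := hulls_separation F0 disj.
pose F' i := if i \in F1 then F1 else F2.
pose q i := [arg min_(H < F' i | (H \in G) && (i \in H)) dot (w i) (p H)]%O.
pose gam i := dot (w i) (p (q i)).
have qP i : i \in F1 :|: F2 -> [/\ q i \in G, i \in q i &
    forall H, H \in G -> i \in H -> gam i <= dot (w i) (p H)].
  move=> iF; rewrite /gam /q; case: Order.TotalTheory.arg_minP => [|H /andP[HG iH] Hmin].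
    by move: iF; rewrite /F' inE; case: ifP => [->|_ /= ->]; rewrite ?G1 ?G2.
  by split=> // H' H'G iH'; apply: Hmin; rewrite H'G.
have gamP i x : i \in F1 :|: F2 -> hull i x -> gam i <= dot (w i) x.
  move=> iF hx; have [_ _ gP] := qP i iF.
  apply: (hx (fun y => gam i <= dot (w i) y)); first exact: convex_halfspace.
  by move=> H HG iH; apply: gP.
have split12 (V : nmodType) (g : 'I_n -> V) :
    \sum_(i in F1 :|: F2) g i = \sum_(i in F1) g i + \sum_(i in F2 :\: F1) g i.
  rewrite (bigID (mem F1)) /=; congr (_ + _); apply: eq_bigl => i; rewrite !inE.
    by case: (i \in F1); rewrite ?andbF.
  by case: (i \in F1); rewrite ?andbF ?andbT.
have gam0 : 0 < \sum_(i in F1) gam i + \sum_(i in F2 :\: F1) gam i.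
  by rewrite -split12; apply: (wP q) => i /qP[].
set g1 := \sum_(i in F1) gam i in gam0; set g2 := \sum_(i in F2 :\: F1) gam i in gam0.
pose f := \sum_(i in F1) w i.
have fE : \sum_(i in F2 :\: F1) w i = - f.
  by apply/eqP; rewrite -addr_eq0 addrC -split12 w0.
have h1 x : (forall i, i \in F1 -> hull i x) -> g1 <= dot f x.
  move=> xP; rewrite dot_suml; apply: ler_sum => i iF; apply: gamP; last exact: xP.
  by rewrite inE iF.
have h2 x : (forall i, i \in F2 -> hull i x) -> g2 <= - dot f x.
  move=> xP; rewrite -dotNl -fE dot_suml; apply: ler_sum => i; rewrite inE => /andP[_ iF].
  by apply: gamP; rewrite ?inE ?iF ?orbT //; apply: xP.
exists f, ((g1 - g2) / 2); split=> x xP.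
  by have := h1 _ xP; lra.
by have := h2 _ xP; lra.
Qed.

End Hull.

(** A point in each nonempty intersection suffices to recover the nerve. *)
Lemma nerve_hull d (A : 'I_n -> 'rV[R]_d -> Prop) : (forall i, convex_pred (A i)) ->
  exists p : {set 'I_n} -> 'rV[R]_d, nerve (hull (nerve A) p) = nerve A.
Proof.
move=> cA.
have /choice[p pP] : forall F, exists x, F \in nerve A -> forall i, i \in F -> A i x.
  move=> F; have [/in_nerve[x xP]|_] := boolP (F \in nerve A); first by exists x.
  by exists 0.
exists p; apply/setP => F; apply/in_nerve/in_nerve => [[x xP]|FA].
  exists x => i /xP hx; apply: hx => // H HA iH; exact: pP.
by exists (p F) => i iF; apply: hull_pt => //; apply/in_nerve.
Qed.

Lemma single_facet_simplex (G : {set {set 'I_n}}) M : down_closed G -> M \in G ->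
  (forall F, facet G F -> F = M) -> G = [set F : {set 'I_n} | F \subset M].
Proof.
move=> dG MG uM; apply/setP => F; rewrite inE; apply/idP/idP => [FG|]; last exact: dG.
by have [H /uM -> ] := facet_above FG.
Qed.

(** The hyperplane dot f x = c carries coordinates in one dimension less, through a
    basis of the kernel of f. *)
Lemma hyperplane_coordinates d (f : 'rV[R]_d) c : f != 0 ->
  exists m (B : 'M[R]_(m, d)) x0, m.+1 = d /\
    forall x, dot f x = c <-> exists y : 'rV[R]_m, x = x0 + y *m B.
Proof.
move=> f0; have ff : dot f f != 0 by rewrite gt_eqF // dot_gt0.
exists (\rank (kermx f^T)), (row_base (kermx f^T)), ((c / dot f f) *: f); split.
  have rf : \rank f^T = 1%N by rewrite mxrank_tr rank_rV f0.
  have := mxrank_ker f^T; rewrite rf => ->; rewrite subn1 prednK //.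
  by have := rank_leq_row f^T; rewrite rf.
have dotE x : (dot f x == 0) = (x <= kermx f^T)%MS.
  rewrite (sameP (sub_kermxP) eqP); apply/eqP/eqP => [e|/matrixP/(_ 0 0)].
    apply/matrixP => i j; rewrite !ord1 !mxE -[RHS]e /dot big_ord1.
    by apply: eq_bigr => k _; rewrite mxE mulrC.
  rewrite !mxE => e; rewrite -[RHS]e /dot big_ord1.
  by apply: eq_bigr => k _; rewrite mxE mulrC.
move=> x; set x0 := _ *: f.
have fx0 : dot f x0 = c by rewrite dotZr divfK.
split=> [fx|[y ->]].
  have : (x - x0 <= row_base (kermx f^T))%MS.
    by rewrite eq_row_base -dotE dotDr dotNr fx fx0 subrr.
  by move/submxP => [y e]; exists y; rewrite -e addrC subrK.
rewrite dotDr fx0; have /eqP -> : dot f (y *m row_base (kermx f^T)) == 0.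
  by rewrite dotE -(eq_row_base (kermx f^T)) submxMl.
by rewrite addr0.
Qed.

(** The crossing point of a segment with a hyperplane. *)
Lemma convex_cross d (A : 'I_n -> 'rV[R]_d -> Prop) F f c x y :
  (forall i, convex_pred (A i)) ->
  (forall i, i \in F -> A i x) -> (forall i, i \in F -> A i y) ->
  c <= dot f x -> dot f y <= c -> exists z, dot f z = c /\ forall i, i \in F -> A i z.
Proof.
move=> cA Ax Ay cx yc; have [e|ne] := eqVneq (dot f x) (dot f y).
  by exists x; split=> //; apply/le_anti; rewrite cx e yc.
have D0 : 0 < dot f x - dot f y.
  by rewrite subr_gt0 lt_neqAle eq_sym ne (le_trans yc).
pose D := dot f x - dot f y.
exists (((c - dot f y) / D) *: x + ((dot f x - c) / D) *: y); split.
  rewrite dotDr !dotZr ![_ / D * _]mulrAC -mulrDl; apply: (mulIf (lt0r_neq0 D0)).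
  rewrite divfK ?lt0r_neq0 // /D; ring.
move=> i iF; apply: (cA i); first exact: Ax.
- exact: Ay.
- by rewrite divr_ge0 ?subr_ge0 // (le_trans yc).
- by rewrite divr_ge0 ?subr_ge0 // (le_trans yc).
rewrite -mulrDl -[RHS](divff (lt0r_neq0 D0)); congr (_ / _); rewrite /D; ring.
Qed.

(** Cut along a hyperplane separating strictly the sets of two facets: the two halves have
    fewer faces, and by convexity a face in both halves meets the hyperplane, whose
    nerve is governed by a smaller dimension. *)
Lemma nerve_acyclic (K : fieldType) d (A : 'I_n -> 'rV[R]_d -> Prop) c :
  (forall i, convex_pred (A i)) -> (d < c)%N -> acyclic_at K (nerve A) c.
Proof.
have [D] := ubnP d; elim: D d A c => // D IHD d A c; rewrite ltnS => dD.
have [N] := ubnP #|nerve A|; elim: N A c => // N IHN A c; rewrite ltnS => AN cA dc.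
have dA := nerve_down_closed (A := A).
have c0 : (0 < c)%N by apply: leq_ltn_trans dc.
have [G0|[F0 F0A]] := set_0Vmem (nerve A).
  by apply: acyclic_empty => F; rewrite G0 inE.
have [F1 fF1 _] := facet_above F0A.
have /facetP [F1A F1max] := fF1.
have [F2 /andP[fF2 nF]|uF] := pickP (fun F2 => facet (nerve A) F2 && (F2 != F1)); last first.
  rewrite (single_facet_simplex dA F1A); first exact: acyclic_simplex.
  by move=> F fF; have := uF F; rewrite fF /= => /negbFE/eqP.
have /facetP [F2A F2max] := fF2.
have [p pE] := nerve_hull cA; pose B := hull (nerve A) p.
have cB i : convex_pred (B i) by apply: hull_convex.
have F12 : F1 :|: F2 \notin nerve A.
  apply: contra nF => F12; rewrite -(F1max _ F12 (subsetUl _ _)).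
  by rewrite {1}(F2max _ F12 (subsetUr _ _)).
have F12n0 : F1 :|: F2 != set0.
  by apply: contraNneq F12 => ->; apply: dA F1A (sub0set _).
have [|f [a [f1 f2]]] := facets_separation (p := p) F1A F2A F12n0.
  by move=> /in_nerve; rewrite pE => h; rewrite h in F12.
have [x1 x1P] : exists x, forall i, i \in F1 -> B i x by apply/in_nerve; rewrite pE.
have [x2 x2P] : exists x, forall i, i \in F2 -> B i x by apply/in_nerve; rewrite pE.
have f0 : f != 0.
  by apply/eqP => f0; have := f1 _ x1P; have := f2 _ x2P; rewrite f0 !dot0l; lra.
have [m [L [x0 [md LP]]]] := hyperplane_coordinates a f0.
pose Bp i x := B i x /\ a <= dot f x.
pose Bm i x := B i x /\ dot f x <= a.
pose Bh i (y : 'rV[R]_m) := B i (x0 + y *m L).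
have cBp i : convex_pred (Bp i) by apply: convexI => //; apply: convex_halfspace.
have cBm i : convex_pred (Bm i) by apply: convexI => //; apply: convexN_halfspace.
have cBh i : convex_pred (Bh i).
  move=> x y s t hx hy s0 t0 st; rewrite /Bh.
  have -> : x0 + (s *: x + t *: y) *m L = s *: (x0 + x *m L) + t *: (x0 + y *m L).
    by rewrite !scalerDr mulmxDl -!scalemxAl addrACA -scalerDl st scale1r.
  exact: cB.
have EU : nerve A = nerve Bp :|: nerve Bm.
  apply/setP => F; rewrite -pE; apply/in_nerve/setUP => [[x xP]|[]/in_nerve[x xP]].
  - have [ax|/ltW xa] := leP a (dot f x); [left|right]; apply/in_nerve.
      by exists x => i iF; split=> //; apply: xP.
    by exists x => i iF; split=> //; apply: xP.
  - by exists x => i /xP[].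
  - by exists x => i /xP[].
have EI : nerve Bp :&: nerve Bm = nerve Bh.
  apply/setP => F; have [->|/set0Pn[i0 i0F]] := eqVneq F set0.
    (* an empty intersection is the whole space, whatever the sets *)
    have in0 k (C : 'I_n -> 'rV[R]_k -> Prop) : set0 \in nerve C.
      by apply/in_nerve; exists 0 => i; rewrite inE.
    by rewrite inE !in0.
  apply/setIP/in_nerve => [[/in_nerve[x xP] /in_nerve[y yP]]|[y yP]].
    have [||||z [/LP [y' zE] zP]] :=
      convex_cross (A := B) (F := F) (f := f) (c := a) (x := x) (y := y) cB.
    - by move=> i /xP[].
    - by move=> i /yP[].
    - by have [] := xP _ i0F.
    - by have [] := yP _ i0F.
    by exists y' => i iF; rewrite /Bh -zE; apply: zP.
  have fa : dot f (x0 + y *m L) = a by apply/LP; exists y.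
  by split; apply/in_nerve; exists (x0 + y *m L) => i /yP iF; split=> //; rewrite fa.
have F1n0 : F1 != set0.
  by apply: contraNneq nF => F10; rewrite (F1max F2) // F10 sub0set.
have F2n0 : F2 != set0.
  by apply: contraNneq nF => F20; rewrite -(F2max F1) // F20 sub0set.
have Bp2 : F2 \notin nerve Bp.
  apply/negP => /in_nerve[x xP]; have [i iF] := set0Pn _ F2n0.
  have [_ ax] := xP _ iF; have := f2 x (fun i iF => proj1 (xP i iF)); lra.
have Bm1 : F1 \notin nerve Bm.
  apply/negP => /in_nerve[x xP]; have [i iF] := set0Pn _ F1n0.
  have [_ ax] := xP _ iF; have := f1 x (fun i iF => proj1 (xP i iF)); lra.
have ltp : (#|nerve Bp| < #|nerve A|)%N.
  by apply/proper_card/properP; split; [rewrite EU subsetUl|exists F2].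
have ltm : (#|nerve Bm| < #|nerve A|)%N.
  by apply/proper_card/properP; split; [rewrite EU subsetUr|exists F1].
have mc : (m < c.-1)%N by rewrite -ltnS prednK // md.
rewrite EU -(prednK c0); apply: acyclic_setU; rewrite ?prednK //.
- exact: nerve_down_closed.
- exact: nerve_down_closed.
- by apply: IHN => //; apply: leq_trans ltp _.
- by apply: IHN => //; apply: leq_trans ltm _.
by rewrite EI; apply: IHD => //; rewrite -ltnS md ltnS.
Qed.

Lemma nerve_Leray (K : fieldType) d (A : 'I_n -> 'rV[R]_d -> Prop) :
  (forall i, convex_pred (A i)) -> Leray K d.+1 (nerve A).
Proof.
move=> cA W c dc.
have -> : induced (nerve A) W = nerve (fun i x => i \in W /\ A i x).
  apply/setP => F; rewrite inE; apply/andP/in_nerve => [[/in_nerve[x xP] FW]|[x xP]].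
    by exists x => i iF; split; [apply: (subsetP FW)|apply: xP].
  split; last by apply/subsetP => i /xP[].
  by apply/in_nerve; exists x => i /xP[].
apply: nerve_acyclic dc => i x y s t [iW Ax] [_ Ay] *; split=> //; exact: cA.
Qed.

End Nerve.

Section Representable.

Import Order.TTheory Num.Theory.

Lemma convex_setP (R : realType) d (A : set 'rV[R]_d) : convex_set A -> convex_pred A.
Proof.
move=> cA x y s t Ax Ay s0 t0 st.
have s1 : s <= 1 by rewrite -st lerDl.
have := cA x y (Itv01 s0 s1); rewrite !in_setE => /(_ Ax Ay).
suff -> : t = 1 - s by [].
by rewrite -st addrC addKr.
Qed.

Lemma Leray_representable (R : realType) (K : fieldType) n d (G : {set {set 'I_n}}) :
  d_representable R d G -> Leray K d.+1 G.
Proof.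
move=> [A [cA GA]].
have -> : G = nerve A.
  by apply/finset.setP => F; apply/idP/in_nerve => /GA.
by apply: nerve_Leray => i; apply: convex_setP.
Qed.

End Representable.

(** * The Koszul complex in a fixed multidegree *)

Section Duality.
Import boot.fintype boot.finset.
Variables (K : fieldType) (n : nat).
Implicit Types (x y : 'I_n) (F H T U W : {set 'I_n}) (f g c b : {set 'I_n} -> K).

(** The Koszul differential of scalar chains within one multidegree: chains are indexed by the
    exterior part. *)
Definition bd c U : K := \sum_(x | x \notin U) sgn K x U * c (x |: U).

Definition contract x c T : K := if x \in T then sgn K x T * c (T :\ x) else 0.

Definition complement_sign W F : K := \prod_(x in F) sgn K x W.

(** Complementation in W turns the differential that adds vertices into the one
    that removes them; the sign absorbs the positions of the vertices inside W. *)
Definition dualize W c F : K := complement_sign W F * c (W :\: F).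

Lemma complement_sign_sq W F : complement_sign W F * complement_sign W F = 1.
Proof. by rewrite -big_split big1 // => x _; rewrite /= sgn_sq. Qed.

Lemma dualize_inj W F c b : dualize W c F = dualize W b F -> c (W :\: F) = b (W :\: F).
Proof.
move=> /(congr1 (fun t => complement_sign W F * t)).
by rewrite /dualize !mulrA complement_sign_sq !mul1r.
Qed.

Lemma sgn_setD x W F : F \subset W -> sgn K x W = sgn K x F * sgn K x (W :\: F).
Proof.
move=> FW; rewrite /sgn -exprD; congr (_ ^+ _).
rewrite -(cardsID F [set y in W | (y < x)%N]); congr addn; apply: eq_card => y.
  rewrite !inE andbAC; congr (_ && _).
  by apply/andP/idP => [[]//|yF]; split=> //; apply: (subsetP FW).
by rewrite !inE andbA.
Qed.

Lemma cobd_dualize W c F : F \subset W -> (forall T, ~~ (T \subset W) -> c T = 0) ->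
  cobd (dualize W c) F = dualize W (bd c) F.
Proof.
move=> FW cW; rewrite /dualize /bd big_distrr (bigID (mem W)) /=.
rewrite [X in _ = _ + X]big1 ?addr0 => [|x /andP[_ xW]]; last first.
  by rewrite cW ?mulr0 // subUset sub1set (negPf xW).
rewrite /cobd; apply: eq_big => [x|x xF].
  rewrite !inE negb_and negbK; apply/idP/andP => [xF|[/orP[]//]].
    by rewrite xF (subsetP FW).
  by move/negPf=> ->.
have xW := subsetP FW _ xF.
have -> : W :\: (F :\ x) = x |: W :\: F.
  by apply/setP=> y; rewrite !inE; case: eqP => // ->; rewrite xW.
rewrite !mulrA; congr (_ * _).
have -> : complement_sign W F = sgn K x W * complement_sign W (F :\ x).
  by rewrite /complement_sign (big_setD1 x xF).
by rewrite (sgn_setD x FW) [RHS]mulrAC -(mulrA (sgn K x F)) sgn_sq mulr1.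
Qed.

Let dual_full c F : cobd (dualize setT c) F = dualize setT (bd c) F.
Proof. by apply: cobd_dualize => [|T]; rewrite subsetT. Qed.

Let setT_K T : setT :\: (setT :\: T) = T :> {set 'I_n}.
Proof. by rewrite !setTD setCK. Qed.

Lemma bd_bd c U : bd (bd c) U = 0.
Proof.
rewrite -(setT_K U); apply: (@dualize_inj _ _ _ (fun _ => 0)).
rewrite -dual_full {2}/dualize mulr0 -[RHS](cobd_cobd (dualize setT c) (setT :\: U)).
by congr cobd; apply: funext => F; rewrite -dual_full.
Qed.

Lemma contract_homotopy x c T : bd (contract x c) T + contract x (bd c) T = c T.
Proof.
have dual_cone b : dualize setT (contract x b) = cone x (dualize setT b).
  apply: funext => F; rewrite /dualize /contract /cone !inE andbT.
  case: ifPn => xF; last by move: xF; rewrite negbK => ->; rewrite mulr0.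
  rewrite (negPf xF) setDDl setUC /complement_sign (big_setU1 _ xF) /= !mulrA.
  congr (_ * _); rewrite (sgn_setD x (subsetT F)) mulrA sgn_sq mul1r.
  exact: mulrC.
rewrite -(setT_K T).
apply: (@dualize_inj _ _ (fun T => bd (contract x c) T + contract x (bd c) T)).
rewrite {1}/dualize mulrDr -/(dualize _ _ _) -/(dualize _ _ _) -dual_full !dual_cone.
rewrite -[RHS](cone_homotopy x); congr (_ + cone x _ _).
by apply: funext => F; rewrite dual_full.
Qed.

Lemma eq_bd c b U i : i = #|U|.+1 -> (forall T, #|T| = i -> c T = b T) -> bd c U = bd b U.
Proof.
by move=> iU cb; apply: eq_bigr => x xU; rewrite cb // cardsU1 xU iU.
Qed.

End Duality.

Section Multidegree.
Import boot.fintype boot.finset.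
Variables (K : fieldType) (n : nat).
Implicit Types (x y : 'I_n) (F H T U W : {set 'I_n}) (c b : {set 'I_n} -> K).
Implicit Types (a m : 'X_{1..n}) (M : pred 'X_{1..n}) (N : pred {set 'I_n}).

Definition set_mnm T : 'X_{1..n} := [multinom (i \in T : nat) | i < n].

Definition supp m : {set 'I_n} := [set i | m i != 0%N].

(** The basis vector of T contributes to multidegree a when the complementary monomial
    exists and satisfies M. *)
Definition cell M a T := (set_mnm T <= a)%MM && M (a - set_mnm T)%MM.

(** Exactness of the Koszul complex of the span of the monomials in M, in multidegree a and
    homological degree i. *)
Definition exact_at M a i := forall c,
  (forall T, #|T| = i -> ~~ cell M a T -> c T = 0) ->
  (forall U, i = #|U|.+1 -> bd c U = 0) ->
  exists b, (forall T, ~~ cell M a T -> b T = 0) /\ (forall T, #|T| = i -> c T = bd b T).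

Lemma set_mnmP T a : reflect (T \subset supp a) (set_mnm T <= a)%MM.
Proof.
apply: (iffP mnm_lepP) => [le|TS i].
  by apply/subsetP => i iT; have := le i; rewrite mnmE iT inE -lt0n.
by rewrite mnmE; case: (boolP (i \in T)) => // /(subsetP TS); rewrite inE -lt0n.
Qed.

Lemma supp_set_mnm T : supp (set_mnm T) = T.
Proof. by apply/setP => i; rewrite inE mnmE; case: (i \in T). Qed.

Lemma mdeg_set_mnm T : mdeg (set_mnm T) = #|T|.
Proof.
rewrite mdegE -sum1_card [RHS]big_mkcond; apply: eq_bigr => i _.
by rewrite mnmE; case: (i \in T).
Qed.

Lemma set_mnmU1 x U : x \notin U -> set_mnm (x |: U) = (set_mnm U + U_(x))%MM.
Proof.
move=> xU; apply/mnmP => i; rewrite mnmDE !mnmE !inE eq_sym.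
by case: eqP => [<-|_]; rewrite ?(negPf xU) // addn0.
Qed.

Lemma cell_set_mnm M W T : cell M (set_mnm W) T = (T \subset W) && M (set_mnm (W :\: T)).
Proof.
rewrite /cell (sameP (set_mnmP _ _) idP) supp_set_mnm; case: (boolP (T \subset W)) => //= TW.
congr M; apply/mnmP => i; rewrite mnmBE !mnmE inE.
by case: (boolP (i \in T)) => [/(subsetP TW) ->|]; rewrite ?subn0.
Qed.

(** Such a vertex x makes the complex a cone. *)
Lemma exact_cone M a i x :
  (forall T, x \notin T -> cell M a T = cell M a (x |: T)) -> exact_at M a i.
Proof.
move=> cellx c cP bdc; pose c' T := if #|T| == i then c T else 0.
have c'P T : ~~ cell M a T -> c' T = 0 by rewrite /c'; case: eqP => // cT; apply: cP.
exists (contract x c'); split=> [T nT|T cT].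
  rewrite /contract; case: ifP => // xT; rewrite c'P ?mulr0 // cellx ?setD1K //.
  by rewrite !inE eqxx.
have -> : c T = c' T by rewrite /c' cT eqxx.
rewrite -[LHS](contract_homotopy x) {2}/contract; case: ifP => xT; last by rewrite addr0.
have iU : i = #|T :\ x|.+1 by rewrite -cT (cardsD1 x T) xT.
rewrite (eq_bd (b := c) iU) ?bdc ?mulr0 ?addr0 // => T' cT'.
by rewrite /c' cT' eqxx.
Qed.

(** These are the cochains of the simplex on W relative to its faces outside N. *)
Definition nonface_exact N W q := forall f : {set 'I_n} -> K,
  (forall F, F \subset W -> #|F| = q -> ~~ N F -> f F = 0) ->
  (forall F, F \subset W -> #|F| = q.+1 -> cobd f F = 0) ->
  exists g, (forall F, F \subset W -> ~~ N F -> g F = 0) /\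
            (forall F, F \subset W -> #|F| = q -> f F = cobd g F).

(** Hochster's formula at the level of chains. *)
Lemma exact_squarefree N W i q : #|W| = (i + q)%N -> nonface_exact N W q ->
  exact_at (fun m => N (supp m)) (set_mnm W) i.
Proof.
move=> cW exN c cP bdc; pose c' T := if #|T| == i then c T else 0.
have cellE T : cell (fun m => N (supp m)) (set_mnm W) T = (T \subset W) && N (W :\: T).
  by rewrite cell_set_mnm supp_set_mnm.
have c'P T : ~~ (T \subset W) -> c' T = 0.
  by move=> TW; rewrite /c'; case: eqP => // cT; rewrite cP // cellE (negPf TW).
have WK T : T \subset W -> W :\: (W :\: T) = T.
  by move=> TW; rewrite setDDr setDv set0U; apply/setIidPr.
have cC F : F \subset W -> (#|F| + #|W :\: F| = i + q)%N.
  by move=> FW; rewrite -cW -(cardsID F W) (setIidPr FW).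
have [F FW cF nF|F FW cF|g [gN gP]] := exN (dualize W c').
- rewrite /dualize /c'; case: eqP => cT; last by rewrite mulr0.
  by rewrite cP ?mulr0 // cellE WK // (negPf nF) andbF.
- rewrite cobd_dualize // /dualize; have := cC _ FW; rewrite cF => e.
  have iU : i = #|W :\: F|.+1 by move: e; rewrite addSn -addnS addnC => /addIn.
  rewrite (eq_bd (b := c) iU) ?bdc ?mulr0 // => T cT.
  by rewrite /c' cT eqxx.
pose b T := if T \subset W then complement_sign K W (W :\: T) * g (W :\: T) else 0.
have bW T : ~~ (T \subset W) -> b T = 0 by rewrite /b => /negPf ->.
exists b; split=> T.
  rewrite cellE /b; case: ifP => //= TW nN.
  by rewrite gN ?mulr0 // subsetDl.
move=> cT; have [TW|nTW] := boolP (T \subset W); last first.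
  rewrite cP ?cellE ?(negPf nTW) // /bd big1 // => x _; rewrite bW ?mulr0 //.
  by apply: contra nTW; apply: subset_trans; exact: subsetUr.
have FW : W :\: T \subset W by apply: subsetDl.
have cF : #|W :\: T| = q.
  by have := cC _ TW; rewrite cT => /addnI.
have -> : c T = c' T by rewrite /c' cT eqxx.
rewrite -(WK T TW); apply: dualize_inj; rewrite -cobd_dualize //.
rewrite gP //; apply: eq_bigr => x xF; congr (_ * _).
rewrite /dualize /b subsetDl WK ?mulrA ?complement_sign_sq ?mul1r //.
exact: subset_trans (subD1set _ _) FW.
Qed.

(** Multidegrees with an exponent at least two are cones: dividing once by that
    variable does not change the support.  The degree bound j only truncates the complex
    beyond the spot under consideration. *)
Lemma exact_monomials N j a i :
  (forall W q, (j < q)%N -> nonface_exact N W q) -> mdeg a <> (i + j)%N ->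
  exact_at (fun m => (j <= mdeg m)%N && N (supp m)) a i.
Proof.
move=> exN /eqP; have degB T : (set_mnm T <= a)%MM -> (mdeg (a - set_mnm T)%MM + #|T| = mdeg a)%N.
  by move=> Ta; rewrite -mdeg_set_mnm -mdegD submK.
rewrite neq_ltn => /orP[lt|gt] c cP bdc.
  exists (fun _ => 0); split=> // T cT.
  rewrite cP // /bd ?big1 // => [x _|]; first by rewrite mulr0.
  apply/negP => /andP[Ta /andP[jm _]]; have := degB _ Ta; rewrite cT => e.
  by move: lt; rewrite -e addnC ltn_add2l ltnNge jm.
suff exa : exact_at (fun m => N (supp m)) a i.
  have [|b [bP cb]] := exa c _ bdc.
    by move=> T cT nT; apply: cP => //; apply: contra nT; rewrite /cell => /andP[-> /andP[]].
  exists (fun T => if #|T| == i.+1 then b T else 0); split=> T; last first.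
    move=> cT; rewrite cb //; apply: eq_bigr => x xT.
    by rewrite cardsU1 xT cT eqxx.
  case: eqP => // cT; rewrite negb_and => /orP[nTa|]; first by rewrite bP // negb_and nTa.
  have [Ta|nTa] := boolP (set_mnm T <= a)%MM; last by rewrite bP // negb_and nTa.
  rewrite negb_and => /orP[|nN]; last by rewrite bP // negb_and nN orbT.
  have := degB _ Ta; rewrite cT => e; move: gt.
  by rewrite -e addnS ltnS addnC leq_add2r => ->.
have [x ax|a1] := pickP (fun x => 1 < a x)%N.
  apply: (@exact_cone _ _ _ x) => T xT; rewrite /cell.
  have -> : (set_mnm T <= a)%MM = (set_mnm (x |: T) <= a)%MM.
    apply/set_mnmP/set_mnmP => [Ta|]; last by apply: subset_trans; exact: subsetUr.
    by rewrite subUset Ta sub1set inE -lt0n (ltnW ax).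
  congr (_ && N _); apply/setP => y; rewrite !inE !mnmBE !mnmE !inE.
  by case: (eqVneq y x) => [->|//]; rewrite (negPf xT) subn0 /= subn1; case: (a x) ax => [|[]].
have -> : a = set_mnm (supp a).
  apply/mnmP => x; rewrite mnmE inE; have := a1 x; by case: (a x) => [|[]].
pose q := (mdeg a - i)%N.
have ia : (i <= mdeg a)%N by apply: leq_trans (leq_addr j i) (ltnW gt).
apply: (@exact_squarefree _ _ _ q); last by apply: exN; rewrite ltn_subRL.
rewrite subnKC // -mdeg_set_mnm; congr mdeg; apply/mnmP => x; rewrite mnmE inE.
by have := a1 x; case: (a x) => [|[]].
Qed.

(** Coning fills a cocycle on the simplex W; on the faces of G the
    filling is a cocycle, and correcting it there makes it vanish on them. *)
Lemma nonface_exact_Leray (G : {set {set 'I_n}}) N j W q :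
  (forall F, (j <= #|F|)%N -> N F = (F \notin G)) -> Leray K j G -> (j < q)%N ->
  nonface_exact N W q.
Proof.
move=> NG LG jq f fN fc; have q0 : (0 < q)%N by apply: leq_ltn_trans jq.
have [W0|[x xW]] := set_0Vmem W.
  exists (fun _ => 0); split=> // F; rewrite W0 subset0 => /eqP -> c0.
  by rewrite -c0 cards0 in q0.
pose g := cone x f.
have fg F : F \subset W -> #|F| = q -> f F = cobd g F.
  move=> FW cF; rewrite -[LHS](cone_homotopy x) {2}/cone; case: ifPn => xF; rewrite ?addr0 //.
  by rewrite fc ?mulr0 ?addr0 // ?subUset ?sub1set ?xW // cardsU1 xF cF.
have jq' : (j <= q.-1)%N by rewrite -ltnS prednK.
have [|h hP] := LG W q.-1 jq' g.
  move=> F; rewrite inE prednK // => /andP[FG FW] cF.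
  by rewrite -fg // fN // NG ?FG // cF ltnW.
exists (fun F => if (F \subset W) && N F then g F - cobd h F else 0); split=> [F ->|F FW cF].
  by move=> /negPf ->.
rewrite fg // -[LHS]subr0 -[X in _ - X](cobd_cobd h F) -cobdB.
have cF' : #|F| = q.-1.+1 by rewrite prednK.
apply: (eq_cobd cF') => H HF cH; rewrite (subset_trans HF FW) /=.
case: ifPn => //; rewrite NG ?cH // negbK => HG.
have HGW : H \in induced G W by rewrite inE HG (subset_trans HF).
by rewrite -(hP _ HGW cH) subrr.
Qed.

(** * The Koszul resolution *)

Notation S := {mpoly K[n]}.
Implicit Types (v u : {set 'I_n} -> S).

Definition koszul_bd v U : S := \sum_(x | x \notin U) sgn K x U *: (v (x |: U) * 'X_x).

Definition component v a T : K := if (set_mnm T <= a)%MM then (v T)@_(a - set_mnm T) else 0.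

Lemma mcoeffMXU (p : S) x m :
  (p * 'X_x)@_m = if m x != 0%N then p@_(m - U_(x)) else 0.
Proof.
case: ifPn => [mx|].
  by have := mcoeffMX p U_(x) (m - U_(x))%MM; rewrite addmC submK // lep1mP.
rewrite negbK => mx; apply/eqP; rewrite mcoeff_eq0 (perm_mem (msuppMX _ _)).
by apply/mapP => -[m' _ e]; move: mx; rewrite e mnmDE mnm1E eqxx.
Qed.

(** The Koszul differential preserves multidegrees, and its components are the scalar one; this
    reduces every statement on Koszul chains to scalar chains. *)
Lemma component_koszul_bd v a : component (koszul_bd v) a = bd (component v a).
Proof.
apply: funext => U; rewrite /component; case: ifPn => [Ua|nUa]; last first.
  rewrite /bd big1 // => x xU; case: ifPn => [|_]; last by rewrite mulr0.
  by move=> /set_mnmP xUa; case/set_mnmP: nUa; apply: subset_trans xUa; exact: subsetUr.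
rewrite /koszul_bd raddf_sum; apply: eq_bigr => x xU /=; rewrite mcoeffZ mcoeffMXU.
congr (_ * _).
have -> : (set_mnm (x |: U) <= a)%MM = ((a - set_mnm U)%MM x != 0%N).
  rewrite mnmBE mnmE (negPf xU) subn0; apply/set_mnmP/idP => [|ax].
    by rewrite subUset sub1set inE => /andP[].
  by rewrite subUset sub1set inE ax; apply/set_mnmP.
by case: ifP => // _; rewrite set_mnmU1 // submDA.
Qed.

Lemma componentP v u : (forall a, component v a = component u a) -> v = u.
Proof.
move=> e; apply: funext => T; apply/mpolyP => m.
have := congr1 (fun c => c T) (e (m + set_mnm T)%MM).
by rewrite /component addmK lem_addl.
Qed.

Lemma koszul_bd_bd v U : koszul_bd (koszul_bd v) U = 0.
Proof.
suff -> : koszul_bd (koszul_bd v) = fun _ => 0 by [].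
apply: componentP => a; rewrite !component_koszul_bd; apply: funext => T.
by rewrite bd_bd /component; case: ifP => // _; rewrite mcoeff0.
Qed.

Lemma bounded_poly (E : 'X_{1..n} -> K) k : (forall m, E m != 0 -> (mdeg m < k)%N) ->
  exists p : S, forall m, p@_m = E m.
Proof.
move=> Ek; exists (\sum_(m : 'X_{1..n < k}) E m *: 'X_[m]) => m.
have [mk|mk] := ltnP (mdeg m) k; first exact: mcoeff_mpoly.
have -> : E m = 0 by apply/eqP; apply: contraLR mk => /Ek; rewrite -ltnNge.
apply: memN_msupp_eq0; apply/negP => /msupp_sum_le /flattenP[s /mapP[b _ ->]].
move=> /msuppZ_le; rewrite msuppX inE => /eqP e; move: mk.
by rewrite e leqNgt bmdeg.
Qed.

(** Koszul cycles are boundaries as soon as they are so in each multidegree; D collects the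
    multidegrees involved and M the monomials allowed as coefficients. *)
Lemma koszul_exact M (D : pred 'X_{1..n}) k i v :
  (forall a, D a -> (mdeg a < k)%N) -> (forall a, D a -> exact_at M a i) ->
  (forall T m, #|T| = i -> m \in msupp (v T) -> M m && D (m + set_mnm T)%MM) ->
  (forall U, i = #|U|.+1 -> koszul_bd v U = 0) ->
  exists u, (forall T, #|T| = i -> v T = koszul_bd u T) /\
    forall T m, m \in msupp (u T) -> M m && D (m + set_mnm T)%MM.
Proof.
move=> Dk exD vMD vc.
have /choice[b bP] : forall a, exists b : {set 'I_n} -> K, D a ->
    (forall T, ~~ cell M a T -> b T = 0) /\
    (forall T, #|T| = i -> component v a T = bd b T).
  move=> a; have [Da|nDa] := boolP (D a); last by exists (fun _ => 0).
  have [T cT nT|U iU|b bP] := exD a Da (component v a); last by exists b.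
    rewrite /component; case: ifP => // Ta; apply: memN_msupp_eq0.
    by apply: contra nT => /(vMD _ _ cT) /andP[Mm _]; rewrite /cell Ta.
  by rewrite -component_koszul_bd /component; case: ifP => // _; rewrite vc // mcoeff0.
pose E T m : K := if D (m + set_mnm T)%MM then b (m + set_mnm T)%MM T else 0.
have /choice[u uP] : forall T, exists p : S, forall m, p@_m = E T m.
  move=> T; apply: (@bounded_poly _ k) => m; rewrite /E; case: ifP => [/Dk mk _|].
    by apply: leq_ltn_trans mk; rewrite mdegD leq_addr.
  by rewrite eqxx.
exists u; split=> [T cT|T m]; last first.
  rewrite mcoeff_msupp uP /E; case: ifP => [Da bm|]; last by rewrite eqxx.
  rewrite andbT; have [bc _] := bP _ Da.
  have : cell M (m + set_mnm T)%MM T by apply: contraNT bm => /bc ->.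
  by rewrite /cell addmK => /andP[].
apply/mpolyP => m; set a := (m + set_mnm T)%MM.
have aT w : (w T)@_m = component w a T by rewrite /component addmK lem_addl.
rewrite !aT component_koszul_bd.
have cu : component u a = fun T' => if D a && (set_mnm T' <= a)%MM then b a T' else 0.
  apply: funext => T'; rewrite /component; case: ifP => T'a; last by rewrite andbF.
  by rewrite uP /E submK // andbT.
have [Da|nDa] := boolP (D a); last first.
  rewrite cu -aT memN_msupp_eq0; last by apply: contra nDa => /(vMD _ _ cT)/andP[].
  by rewrite /bd big1 // => x _; rewrite (negPf nDa) mulr0.
have [bc ->//] := bP _ Da; apply: eq_bigr => x _; rewrite cu Da /=.
by case: ifPn => // nT; rewrite bc ?mulr0 // /cell (negPf nT).
Qed.

Definition koszul_gen i : finType := {T : {set 'I_n} | #|T| == i}.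

Definition koszul_coef T U : S := \sum_(x in T | U == T :\ x) sgn K x U *: 'X_x.

(** Chains of the resolution are indexed by sets of a fixed size; extending them by zero to all sets
    removes this dependency. *)
Definition extend i (w : {ffun koszul_gen i -> S}) T : S :=
  if insub T is Some k then w k else 0.

Lemma extend_val i (w : {ffun koszul_gen i -> S}) k : extend w (val k) = w k.
Proof. by rewrite /extend valK. Qed.

Lemma extend_card i (w : {ffun koszul_gen i -> S}) T : #|T| <> i -> extend w T = 0.
Proof. by move=> cT; rewrite /extend insubN //; apply/eqP. Qed.

Lemma koszul_sum i (w : {ffun koszul_gen i -> S}) U :
  \sum_k w k * koszul_coef (val k) U = koszul_bd (extend w) U.
Proof.
have -> : \sum_k w k * koszul_coef (val k) U = \sum_T extend w T * koszul_coef T U.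
  rewrite [RHS](bigID (fun T : {set 'I_n} => #|T| == i)) /= [X in _ + X]big1 ?addr0.
    rewrite (reindex_omap (val : koszul_gen i -> _) insub) /=; last first.
      by move=> T cT; rewrite insubT.
    apply: eq_big => [k|k _]; first by rewrite valK eqxx (valP k).
    by rewrite extend_val.
  by move=> T /eqP cT; rewrite extend_card // mul0r.
rewrite /koszul_coef; under eq_bigr => T _ do rewrite big_distrr /=.
rewrite (exchange_big_dep (fun x => x \notin U)) /=; last first.
  by move=> T x _ /andP[_ /eqP ->]; rewrite !inE eqxx.
apply: eq_bigr => x xU; rewrite (big_pred1 (x |: U)) => [|T].
  by rewrite -scalerAr.
apply/andP/eqP => [[xT /eqP ->]|->]; first by rewrite setD1K.
by rewrite setU11 setU1K.
Qed.

Lemma koszul_ffun i (w : {ffun koszul_gen i.+1 -> S}) (v : {ffun koszul_gen i -> S}) :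
  v = [ffun l => \sum_k w k * koszul_coef (val k) (val l)] <->
  forall T, #|T| = i -> extend v T = koszul_bd (extend w) T.
Proof.
split=> [-> T /eqP cT|e].
  by have := extend_val [ffun l => \sum_k w k * koszul_coef (val k) (val l)]
    (Sub T cT : koszul_gen i); rewrite SubK => ->; rewrite ffunE koszul_sum.
by apply/ffunP => l; rewrite ffunE koszul_sum -e ?extend_val //; apply/eqP/(valP l).
Qed.

Lemma extend_finfun i v T : #|T| = i ->
  extend [ffun k : koszul_gen i => v (val k)] T = v T.
Proof.
move=> /eqP cT; have := extend_val [ffun k : koszul_gen i => v (val k)] (Sub T cT).
by rewrite SubK ffunE SubK.
Qed.

Lemma koszul_bd_extend i v T : #|T| = i ->
  koszul_bd (extend [ffun k : koszul_gen i.+1 => v (val k)]) T = koszul_bd v T.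
Proof.
move=> cT; apply: eq_bigr => x xT; rewrite extend_finfun //.
by rewrite cardsU1 xT cT.
Qed.

Lemma koszul_coef_homog i (k : koszul_gen i.+1) (l : koszul_gen i) :
  shifted_homog i i.+1 (koszul_coef (val k) (val l)).
Proof.
right; rewrite leqnSn subSnn; split=> //; apply: rpred_sum => x _.
by apply: rpredZ; rewrite dhomogX /= mdeg1.
Qed.

Lemma exact_koszul a i : (0 < i)%N || (a != 0%MM) -> exact_at predT a i.
Proof.
move=> ia; have [x ax|a0] := pickP (fun x => a x != 0%N).
  apply: (@exact_cone _ _ _ x) => T xT; rewrite /cell !andbT.
  apply/set_mnmP/set_mnmP => [Ta|]; last by apply: subset_trans; exact: subsetUr.
  by rewrite subUset Ta sub1set inE ax.
have a00 : a = 0%MM by apply/mnmP => x; rewrite mnm0E; apply/eqP/negbFE/a0.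
rewrite a00 eqxx orbF in ia.
have cellN T : #|T| = i -> ~~ cell predT a T.
  move=> cT; rewrite /cell andbT; apply/negP => /set_mnmP Ta; move: ia; rewrite -cT.
  rewrite card_gt0 => /set0Pn[x /(subsetP Ta)]; by rewrite inE a0.
move=> c cP _; exists (fun _ => 0); split=> // T cT.
by rewrite cP ?cellN // /bd big1 // => x _; rewrite mulr0.
Qed.

Lemma koszul_diff_exact i (v : {ffun koszul_gen i.+1 -> S}) :
  [ffun l : koszul_gen i => \sum_k v k * koszul_coef (val k) (val l)] = 0 <->
  exists u : {ffun koszul_gen i.+2 -> S},
    v = [ffun l => \sum_k u k * koszul_coef (val k) (val l)].
Proof.
have cyc : [ffun l : koszul_gen i => \sum_k v k * koszul_coef (val k) (val l)] = 0 <->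
    forall T, #|T| = i -> koszul_bd (extend v) T = 0.
  have := koszul_ffun v 0; rewrite (_ : extend 0 = fun _ => 0); last first.
    by apply: funext => T; rewrite /extend; case: insub => // k; rewrite ffunE.
  by move=> [h1 h2]; split=> [/esym/h1 h T cT|h]; [rewrite -h|apply/esym/h2 => T /h].
split=> [/cyc vc|[u /koszul_ffun e]]; last first.
  apply/cyc => T cT; rewrite -[RHS](koszul_bd_bd (extend u) T).
  by apply: eq_bigr => x xT; rewrite e // cardsU1 xT cT.
pose k := (\max_(T : {set 'I_n}) (msize (extend v T) + #|T|))%N.
have [a|a _|T m cT mv|U [iU]|u [uP _]] :=
  @koszul_exact predT (fun a => mdeg a < k)%N k i.+1 (extend v).
- by [].
- by apply: exact_koszul.
- rewrite /= mdegD mdeg_set_mnm; apply: leq_trans (leq_bigmax T).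
  by rewrite -addSn leq_add2r; apply: msize_mdeg_lt.
- exact: vc.
exists [ffun k : koszul_gen i.+2 => u (val k)]; apply/koszul_ffun => T cT.
by rewrite koszul_bd_extend // uP.
Qed.

Definition set0_gen : koszul_gen 0 := Sub set0 (introT eqP (cards0 _)).

Lemma gen0 (k : koszul_gen 0) : k = set0_gen.
Proof. by apply: val_inj => /=; apply: cards0_eq; apply/eqP/(valP k). Qed.

Lemma koszul_aug_exact (v : {ffun koszul_gen 0 -> S}) :
  \sum_k (v k)@_0%MM * 1 = 0 <->
  exists u : {ffun koszul_gen 1 -> S}, v = [ffun l => \sum_k u k * koszul_coef (val k) (val l)].
Proof.
have -> : \sum_k (v k)@_0%MM * 1 = (extend v set0)@_0%MM.
  rewrite (big_pred1 set0_gen) => [|k]; last by rewrite [k]gen0 /= eqxx.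
  by rewrite mulr1 -(extend_val v).
split=> [v0|[u /koszul_ffun e]]; last first.
  rewrite e ?cards0 // /koszul_bd raddf_sum big1 // => x _ /=.
  by rewrite mcoeffZ mcoeffMXU mnm0E eqxx mulr0.
pose k := msize (extend v set0).
have [a /andP[]//|a /andP[_ a0]|T m cT mv|//|u [uP _]] :=
  @koszul_exact predT (fun a => (mdeg a < k)%N && (a != 0%MM)) k 0 (extend v).
- by apply: exact_koszul; rewrite a0.
- move: mv; rewrite (cards0_eq cT) => mv; rewrite /= mdegD mdeg_set_mnm cards0 addn0.
  rewrite msize_mdeg_lt //=; apply/eqP => m0; move: mv.
  have -> : m = 0%MM.
    apply/eqP; rewrite -mdeg_eq0 -(addn0 (mdeg m)) -[X in (_ + X)%N](cards0 'I_n).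
    by rewrite -mdeg_set_mnm -mdegD m0 mdeg0.
  by rewrite mcoeff_msupp v0 eqxx.
exists [ffun k : koszul_gen 1 => u (val k)]; apply/koszul_ffun => T cT.
by rewrite koszul_bd_extend // uP.
Qed.

(** The generator of a set of size i sits in degree i. *)
Definition koszul : free_resolution K n.
Proof.
refine (@FreeResolution K n koszul_gen (fun i _ => i)
  (fun i k l => koszul_coef (val k) (val l)) (fun _ => 1) _ _ _ _ _).
- exact: koszul_coef_homog.
- by [].
- by exists set0_gen; rewrite oner_eq0.
- exact: koszul_aug_exact.
- exact: koszul_diff_exact.
Defined.

(** Squarefree multidegrees decide: a monomial ideal whose membership depends only on
    the support, once the degree is at least j, has a j-linear resolution when
    the complexes of its nonfaces are exact above cardinality j. *)
Lemma linear_resolution_monomials (J : set S) N j :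
  (forall p, J p <-> forall m, m \in msupp p -> (j <= mdeg m)%N && N (supp m)) ->
  (forall W q, (j < q)%N -> nonface_exact N W q) -> linear_resolution j J.
Proof.
move=> JE exN i j' nj; exists koszul, (fun _ => 0).
split=> [[]//|v vc]; exists [ffun _ => 0]; split; last first.
  by move=> c _; apply/ffunP => -[].
rewrite big_ord0 subr0.
have [vt vb] : tensor_part (P := koszul) J j' v /\
    forall U, i = #|U|.+1 -> koszul_bd (extend v) U = 0.
  case: i nj v vc => [|i] nj v; first by split.
  move=> [vt b0]; split=> // U [iU].
  have := (koszul_ffun v 0).1 (esym b0) U (esym iU) => <-.
  by rewrite /extend; case: insub => // k; rewrite ffunE.
pose M m := (j <= mdeg m)%N && N (supp m).
have [a /eqP -> //|a /eqP aj|T m cT|//|u [uP uD]] :=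
  @koszul_exact M (fun a => mdeg a == j') j'.+1 i (extend v).
- by apply: exact_monomials => //; rewrite aj.
- have [Jv hv] := vt (Sub T (introT eqP cT)).
  have -> : extend v T = v (Sub T (introT eqP cT)) by rewrite -extend_val.
  move=> mv; rewrite /M ((JE _).1 Jv _ mv) /= mdegD mdeg_set_mnm cT.
  case: hv => [v0|[ij /dhomogP/(_ _ mv) ->]]; last by rewrite subnK.
  by rewrite v0 msupp0 in mv.
exists [ffun k : koszul_gen i.+1 => u (val k)]; last first.
  by apply/koszul_ffun => T cT; rewrite koszul_bd_extend // uP.
move=> k; rewrite ffunE; split; first by apply/JE => m /uD /andP[].
have ck := eqP (valP k); have [->|u0] := eqVneq (u (val k)) 0; [by left|right].
have uk m : m \in msupp (u (val k)) -> (mdeg m + i.+1 = j')%N.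
  by move=> /uD /andP[_ /eqP <-]; rewrite mdegD mdeg_set_mnm ck.
have /uk e := mlead_supp u0; split; first by rewrite -e leq_addl.
by apply/dhomogP => m /uk <-; rewrite addnK.
Qed.

End Multidegree.

(** * Monomial ideals and their complexes *)

Section MonomialIdeals.
Import boot.fintype boot.finset.
Variables (K : fieldType) (n : nat).
Notation S := {mpoly K[n]}.
Implicit Types (m : 'X_{1..n}) (F H W : {set 'I_n}) (G : {set {set 'I_n}}) (p : S).

Lemma xmonE F : xmon F = 'X_[set_mnm F] :> S.
Proof.
rewrite /xmon mprodXE; congr mpolyX; apply/mnmP => i.
rewrite mnm_sumE mnmE big_mkcond (bigD1 i) //= big1 ?addn0.
  by case: (i \in F); rewrite ?mnm1E ?eqxx.
by move=> j nj; case: ifP => // _; rewrite mnm1E (negPf nj).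
Qed.

Lemma set_mnm_supp_le m : (set_mnm (supp m) <= m)%MM.
Proof. exact/set_mnmP. Qed.

Lemma card_supp m : (#|supp m| <= mdeg m)%N.
Proof.
have := congr1 mdeg (submK (set_mnm_supp_le m)); rewrite mdegD mdeg_set_mnm => <-.
exact: leq_addl.
Qed.

Lemma supp_mono m m' : (m' <= m)%MM -> supp m' \subset supp m.
Proof.
move/mnm_lepP => le; apply/subsetP => i; rewrite !inE -!lt0n => /leq_trans; exact.
Qed.

(** The elements of A need not be monomials; it is enough that A contains a monomial below each
    exponent in U. *)
Lemma ideal_gen_monomials (A : set S) (U : 'X_{1..n} -> Prop) :
  (forall m m', (m' <= m)%MM -> U m' -> U m) ->
  (forall p, A p -> forall m, m \in msupp p -> U m) ->
  (forall m, U m -> exists2 m', (m' <= m)%MM & A 'X_[m']) ->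
  forall p, ideal_gen A p <-> forall m, m \in msupp p -> U m.
Proof.
move=> Uup AU UA p; split=> [[s sA ->] m|pU].
  move=> /msupp_sum_le /flattenP[_ /mapP[cg cgs ->] /msuppM_le].
  move: cgs; rewrite mem_filter => /sA Acg /allpairsP[[m1 m2] /= [_ m2s ->]].
  by apply: Uup (AU _ Acg _ m2s); rewrite lem_addl.
have /choice[f fP] : forall m, exists m', m \in msupp p -> (m' <= m)%MM /\ A 'X_[m'].
  move=> m; have [/pU /UA [m' le Am']|nm] := boolP (m \in msupp p); first by exists m'.
  by exists m.
exists [seq (p@_m *: 'X_[m - f m], 'X_[f m]) | m <- msupp p].
  by move=> cg /mapP[m mp ->] /=; have [] := fP _ mp.
rewrite [LHS]mpolyE [RHS]big_map [LHS]big_seq [RHS]big_seq; apply: eq_bigr => m mp.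
by have [le _] := fP _ mp; rewrite /= -scalerAl -mpolyXD submK.
Qed.

Lemma eq_ideal (J J' : set S) (U : 'X_{1..n} -> Prop) :
  (forall p, J p <-> forall m, m \in msupp p -> U m) ->
  (forall p, J' p <-> forall m, m \in msupp p -> U m) -> J = J'.
Proof. by move=> JU J'U; apply: funext => p; apply: propext; rewrite JU J'U. Qed.

Lemma SR_idealP G : down_closed G ->
  forall p, SR_ideal K G p <-> forall m, m \in msupp p -> supp m \notin G.
Proof.
move=> dG; apply: ideal_gen_monomials => [m m' le|_ [F FG ->] m|m mG].
- by apply: contra => /dG; apply; apply: supp_mono.
- by rewrite xmonE msuppX inE => /eqP ->; rewrite supp_set_mnm.
by exists (set_mnm (supp m)); [exact: set_mnm_supp_le|exists (supp m); rewrite ?xmonE].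
Qed.

Lemma SR_ideal_X G : down_closed G -> forall m, SR_ideal K G 'X_[m] <-> supp m \notin G.
Proof.
move=> dG m; rewrite SR_idealP //; split=> [->//|mG m']; first by rewrite msuppX inE.
by rewrite msuppX inE => /eqP ->.
Qed.

Lemma SR_complexK (I : set S) : squarefree_monomial_ideal I ->
  down_closed (SR_complex I) /\ I = SR_ideal K (SR_complex I).
Proof.
move=> [B IB]; pose U m := exists2 F, F \in B & F \subset supp m.
have IU p : I p <-> forall m, m \in msupp p -> U m.
  rewrite IB; apply: ideal_gen_monomials => [m m' le [F FB Fm']|_ [F FB ->] m|m [F FB Fm]].
  - by exists F => //; apply: subset_trans Fm' (supp_mono le).
  - by rewrite xmonE msuppX inE => /eqP ->; exists F; rewrite ?supp_set_mnm.
  by exists (set_mnm F); [exact/set_mnmP|exists F; rewrite ?xmonE].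
have GU F : F \notin SR_complex I <-> exists2 F', F' \in B & F' \subset F.
  rewrite inE; split=> [|[F' FB FF]].
    move/asboolP/contrapT/IU => /(_ (set_mnm F)); rewrite xmonE msuppX inE eqxx /U supp_set_mnm.
    by apply.
  apply/asboolP; apply; apply/IU => m; rewrite xmonE msuppX inE => /eqP ->.
  by exists F'; rewrite ?supp_set_mnm.
have dG : down_closed (SR_complex I).
  move=> F H FG HF; apply: contraLR FG => /GU[F' FB FF]; apply/GU; exists F' => //.
  exact: subset_trans HF.
split=> //; apply: (eq_ideal IU) => p; rewrite SR_idealP //.
by split=> h m /h /GU.
Qed.

Lemma notin_clique j G F :
  reflect (exists H, [/\ H \subset F, #|H| = j & H \notin G]) (F \notin clique j G).
Proof.
rewrite inE negb_forall; apply: (iffP existsP) => -[H].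
  by rewrite negb_imply => /andP[/andP[HF /eqP cH] HG]; exists H.
by move=> [HF cH HG]; exists H; rewrite HF cH eqxx HG.
Qed.

Lemma squarefree_partP j G : down_closed G -> forall p,
  squarefree_part (SR_ideal K G) j p <-> forall m, m \in msupp p -> supp m \notin clique j G.
Proof.
move=> dG; apply: ideal_gen_monomials => [m m' le|_ [F [cF -> /SR_idealP FG]] m|m].
- by apply: contra => /clique_down_closed; apply; apply: supp_mono.
- rewrite xmonE msuppX inE => /eqP ->; apply/notin_clique; exists F; rewrite supp_set_mnm.
  split=> //; have := FG dG (set_mnm F); rewrite xmonE msuppX inE eqxx supp_set_mnm.
  exact.
move=> /notin_clique[H [Hm cH HG]]; exists (set_mnm H); first exact/set_mnmP.
by exists H; rewrite xmonE; split=> //; apply/SR_ideal_X; rewrite ?supp_set_mnm.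
Qed.

Lemma squarefree_part_clique j G : down_closed G ->
  squarefree_part (SR_ideal K G) j = SR_ideal K (clique j G).
Proof.
move=> dG; apply: (eq_ideal (U := fun m => supp m \notin clique j G)).
  exact: squarefree_partP.
exact: SR_idealP (clique_down_closed (j := j) (G := G)).
Qed.

Lemma linear_squarefree_part j G : down_closed G -> Leray K j (clique j G) ->
  linear_resolution j (squarefree_part (SR_ideal K G) j).
Proof.
move=> dG LG; apply: (@linear_resolution_monomials _ _ _ (fun F => F \notin clique j G)).
  move=> p; rewrite squarefree_partP //; split=> h m /h; last by case/andP.
  move=> mG; rewrite mG andbT; have /notin_clique[H [Hm <- _]] := mG.
  exact: leq_trans (subset_leq_card Hm) (card_supp m).
by move=> W q jq; apply: (nonface_exact_Leray _ LG).
Qed.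

Lemma set_between j H F : H \subset F -> (#|H| <= j)%N -> (j <= #|F|)%N ->
  exists H', [/\ H \subset H', H' \subset F & #|H'| = j].
Proof.
move=> HF Hj; rewrite -(subnKC Hj); elim: (j - _)%N => [|k IH] kF; first by exists H; rewrite addn0.
have [|H' [HH' H'F cH']] := IH; first by apply: leq_trans kF; rewrite leq_add2l.
have /properP[_ [x xF xH']] : H' \proper F by rewrite properEcard H'F cH' -addnS.
exists (x |: H'); rewrite cardsU1 xH' cH' addnS; split=> //.
  by apply: subset_trans HH' (subsetUr _ _).
by rewrite subUset sub1set xF.
Qed.

Lemma monomial_between j m1 m2 : (m1 <= m2)%MM -> (mdeg m1 <= j)%N -> (j <= mdeg m2)%N ->
  exists m', [/\ (m1 <= m')%MM, (m' <= m2)%MM & mdeg m' = j].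
Proof.
move=> le1 dj; rewrite -(subnKC dj); elim: (j - _)%N => [|k IH] kF.
  by exists m1; rewrite addn0 lepm_refl.
have [|m' [le le2 dm']] := IH; first by apply: leq_trans kF; rewrite leq_add2l.
have [x mx|mm] := pickP (fun x => m' x < m2 x)%N; last first.
  move: kF; suff -> : m2 = m' by rewrite dm' leq_add2l ltnn.
  apply/mnmP => x; apply/eqP; rewrite eqn_leq (mnm_lepP le2) andbT leqNgt.
  by rewrite (mm x).
exists (m' + U_(x))%MM; rewrite mdegD mdeg1 dm' addn1 addnS; split=> //.
  by apply: lepm_trans le (lem_addr _ _).
apply/mnm_lepP => y; rewrite mnmDE mnm1E; case: eqP => [<-|_]; rewrite ?addn1 //.
by rewrite addn0 (mnm_lepP le2).
Qed.

(** The supports of the monomials lying in the ideal generated by the nonfaces of size at most j. *)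
Definition has_nonface j G F :=
  [exists H : {set 'I_n}, [&& H \subset F, (#|H| <= j)%N & H \notin G]].

Lemma has_nonfaceP j G F :
  reflect (exists H, [/\ H \subset F, (#|H| <= j)%N & H \notin G]) (has_nonface j G F).
Proof. by apply: (iffP existsP) => -[H] => [/and3P|/and3P]; exists H. Qed.

Lemma degree_partP j G : down_closed G -> forall p, degree_part (SR_ideal K G) j p <->
  forall m, m \in msupp p -> (j <= mdeg m)%N && has_nonface j G (supp m).
Proof.
move=> dG.
apply: (ideal_gen_monomials (U := fun m => (j <= mdeg m)%N && has_nonface j G (supp m))).
- move=> m m' le /andP[jm /has_nonfaceP[H [Hm Hj HG]]]; apply/andP; split.
    by apply: leq_trans jm _; rewrite -(submK le) mdegD leq_addl.
  by apply/has_nonfaceP; exists H; split=> //; apply: subset_trans Hm (supp_mono le).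
- move=> p [/SR_idealP pG /dhomogP pj] m mp; rewrite (pj _ mp) leqnn.
  apply/has_nonfaceP; exists (supp m); split=> //; last exact: pG.
  by rewrite -(pj _ mp) card_supp.
move=> m /andP[jm /has_nonfaceP[H [Hm Hj HG]]].
have [|||m' [Hm' m'm dm']] := @monomial_between j (set_mnm H) m; rewrite ?mdeg_set_mnm //.
  exact/set_mnmP.
exists m' => //; split; last by rewrite dhomogX /= dm'.
by apply/SR_ideal_X => //; apply: contra HG => /dG; apply; apply/set_mnmP.
Qed.

(** In cardinality at least j the small nonfaces may be enlarged to size j, so
    that only the closure of G in size j matters. *)
Lemma has_nonface_clique j G F : down_closed G -> (j <= #|F|)%N ->
  has_nonface j G F = (F \notin clique j G).
Proof.
move=> dG jF; apply/has_nonfaceP/notin_clique => -[H [HF Hj HG]]; last first.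
  by exists H; rewrite Hj.
have [H' [HH' H'F cH']] := set_between HF Hj jF; exists H'; split=> //.
by apply: contra HG => /dG; apply.
Qed.

(** Truncation in degree j does not spoil linearity: the condition only sees nonfaces of size
    at least j. *)
Lemma linear_degree_part j G : down_closed G -> Leray K j (clique j G) ->
  linear_resolution j (degree_part (SR_ideal K G) j).
Proof.
move=> dG LG; apply: (@linear_resolution_monomials _ _ _ (has_nonface j G)) => [|W q jq].
  exact: degree_partP.
by apply: (nonface_exact_Leray _ LG) => // F jF; apply: has_nonface_clique.
Qed.

Lemma Leray_clique0 G : set0 \notin G -> Leray K 0 (clique 0 G).
Proof.
move=> nG W c _; apply: acyclic_empty => F; rewrite inE => /andP[/in_clique FG _].
by have := FG set0 (sub0set _) (cards0 _); rewrite (negPf nG).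
Qed.

(** The sets without nonface of size one are the sets of vertices of G, which form a simplex. *)
Lemma Leray_clique1 G : Leray K 1 (clique 1 G).
Proof.
apply: (eq_Leray _ (@Leray_simplex K n [set i | [set i] \in G] 1 isT)) => F _.
rewrite inE; apply/subsetP/in_clique => [FG H HF /eqP/cards1P[i e]|FG i iF].
  by have := FG i; rewrite e in HF *; rewrite inE => ->//; rewrite -sub1set.
by rewrite inE; apply: FG; rewrite ?sub1set ?cards1.
Qed.

Lemma Leray_no_nonface j G : (0 < j)%N -> (forall H, #|H| = j -> H \in G) ->
  Leray K j (clique j G).
Proof.
move=> j0 jG; apply: (eq_Leray _ (@Leray_simplex K n setT j j0)) => F _.
by rewrite inE subsetT; symmetry; apply/in_clique => H _; apply: jG.
Qed.

Lemma Leray_leq i j G : (i <= j)%N -> Leray K i G -> Leray K j G.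
Proof. by move=> ij LG W c jc; apply: LG; apply: leq_trans jc. Qed.

(** Degrees zero and one impose nothing: the ideal generated in degree zero is trivial, and the one
    generated by variables corresponds to a simplex. *)
Lemma componentwise_linear_SR G : down_closed G ->
  (forall j, (2 <= j)%N -> Leray K j (clique j G)) -> componentwise_linear (SR_ideal K G).
Proof.
move=> dG LG [|[|j]]; last 2 first.
- by apply: linear_degree_part => //; apply: Leray_clique1.
- by apply: linear_degree_part => //; apply: LG.
have [G0|nG] := boolP (set0 \in G); last first.
  by apply: linear_degree_part => //; apply: Leray_clique0.
apply: (@linear_resolution_monomials _ _ _ (has_nonface 0 G)) => [|W q q0 f fN _].
  exact: degree_partP.
have noN F : ~~ has_nonface 0 G F.
  by apply/negP => /has_nonfaceP[H [_]]; rewrite leqn0 cards_eq0 => /eqP ->; rewrite G0.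
exists (fun _ => 0); split=> // F FW cF.
by rewrite fN // /cobd big1 // => x _; rewrite mulr0.
Qed.

Lemma minimal_generator_below G F : down_closed G -> F \notin G ->
  exists H, [/\ H \subset F, H \notin G & minimal_monomial_generator (SR_ideal K G) (set_mnm H)].
Proof.
move=> dG FG; have [H /minsetP[HG Hmin] HF] := minset_exists (P := fun H => H \notin G) FG.
exists H; split=> //; split; first by apply/SR_ideal_X; rewrite ?supp_set_mnm.
move=> m le /SR_ideal_X mG.
have sm : supp m = H.
  by apply: Hmin; [exact: mG|have := supp_mono le; rewrite supp_set_mnm].
apply/mnmP => i; apply/eqP; rewrite eqn_leq (mnm_lepP le).
by have := mnm_lepP (set_mnm_supp_le m) i; rewrite sm.
Qed.

(** When all minimal nonfaces have at most s elements, so do the obstructions in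
    larger sizes. *)
Lemma Leray_clique_above s j G : down_closed G ->
  (forall F, F \notin G -> exists H, [/\ H \subset F, H \notin G & (#|H| <= s)%N]) ->
  (s <= j)%N -> Leray K s (clique s G) -> Leray K j (clique j G).
Proof.
move=> dG small sj /(Leray_leq sj); apply: eq_Leray => F jF.
apply: negb_inj; apply/notin_clique/notin_clique => -[H [HF cH HG]].
  have [|H' [HH' H'F cH']] := @set_between j H F HF _ jF; first by rewrite cH.
  by exists H'; split=> //; apply: contra HG => /dG; apply.
have [H0 [H0H H0G H0s]] := small H HG.
have [|H' [H0H' H'H cH']] := @set_between s H0 H H0H H0s; first by rewrite cH.
exists H'; split=> //; first exact: subset_trans HF.
by apply: contra H0G => /dG; apply.
Qed.

End MonomialIdeals.

Section OnVertices.
Import boot.fintype boot.finset.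
Variables (K : fieldType) (n : nat) (W : {set 'I_n}) (G : {set {set 'I_n}}).

Lemma enum_val_mono : {mono (@enum_val _ (mem W)) : x y / (x < y)%N}.
Proof.
have srt : sorted ltn (map val (enum W)).
  apply: (subseq_sorted ltn_trans (s1 := map val (enum W)) (s2 := map val (enum 'I_n))).
    by apply: map_subseq; rewrite {1}/enum_mem enumT filter_subseq.
  by rewrite val_enum_ord iota_ltn_sorted.
have homo (x y : 'I_#|W|) : (x < y)%N -> (enum_val x < enum_val y)%N.
  move=> xy; have x0 : 'I_n by exact: enum_val x.
  rewrite !(enum_val_nth x0) -!(nth_map x0 0%N val) -?cardE //.
  by apply: (sorted_ltn_nth ltn_trans) => //; rewrite inE size_map -cardE.
move=> x y; apply/idP/idP; last exact: homo.
case: (ltngtP x y) => // [/homo /ltnW|/ord_inj ->]; last by rewrite ltnn.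
by rewrite leqNgt => /negPf ->.
Qed.

(** Restricting to W is implied by the relabelling, whose image lies in W. *)
Lemma on_verticesE :
  on_vertices W (induced G W) = [set H : {set 'I_#|W|} | enum_val @: H \in G].
Proof.
apply/setP => H; rewrite !inE andb_idr // => _; apply/subsetP => _ /imsetP[x _ ->].
exact: enum_valP.
Qed.

Lemma on_vertices_down_closed : down_closed G -> down_closed (on_vertices W (induced G W)).
Proof.
move=> dG F H; rewrite on_verticesE !inE => FG HF; apply: dG FG _; exact: imsetS.
Qed.

Lemma Leray_on_vertices j : Leray K j (clique j G) ->
  Leray K j (clique j (on_vertices W (induced G W))).
Proof.
have eI := @enum_val_inj _ (mem W).
move=> /(Leray_relabel enum_val_mono); apply: eq_Leray => F _.
rewrite inE on_verticesE; apply/in_clique/in_clique => FG H HF cH.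
  by rewrite inE; apply: FG; [exact: imsetS|rewrite card_imset].
have eH : H = enum_val @: (@enum_val _ (mem W) @^-1: H).
  apply/setP => y; apply/idP/imsetP => [yH|[x]]; last by rewrite inE => xH ->.
  by have /imsetP[x xF e] := subsetP HF _ yH; exists x => //; rewrite inE -e.
have := FG (@enum_val _ (mem W) @^-1: H); rewrite inE -eH; apply.
  by apply/subsetP => x; rewrite inE => /(subsetP HF) /imsetP[y yF /eI ->].
by rewrite -cH [in RHS]eH card_imset.
Qed.

End OnVertices.

Theorem theorem4p6 (R : realType) (K : fieldType) (n d : nat)
    (I : set {mpoly K[n]}) (hI : squarefree_monomial_ideal I)
    (hI0 : exists2 p, I p & p != 0) (hd : (0 < d)%N) :
  let G := SR_complex I in
  (* (a) *)
  (d_chordal d G ->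
    squarefree_part I d.+1 = SR_ideal K (d_closure d G) /\
    linear_resolution d.+1 (squarefree_part I d.+1)) /\
  (* (b) *)
  (d_chordal d G -> forall W : {set 'I_n},
    linear_resolution d.+1
      (squarefree_part (SR_ideal K (on_vertices W (induced G W))) d.+1)) /\
  (* (c) *)
  (d_collapsible d G ->
    squarefree_part I d.+1 = SR_ideal K (d_closure d G) /\
    linear_resolution d.+1 (squarefree_part I d.+1)) /\
  (* (d) *)
  (d_representable R d G ->
    squarefree_part I d.+1 = SR_ideal K (d_closure d G) /\
    linear_resolution d.+1 (squarefree_part I d.+1)) /\
  (* (e) *)
  (chordal G -> componentwise_linear I) /\
  (* (f) *)
  (forall t s : nat,
    smallest_generator_degree I t -> largest_generator_degree I s ->
    (forall d' : nat, (0 < d')%N -> (t <= d'.+1)%N -> (d'.+1 <= s)%N ->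
      d_chordal d' G) ->
    componentwise_linear I) /\
  (* (g) *)
  (d_collapsible d G ->
    (forall m : 'X_{1..n}, I 'X_[m] -> (d < mdeg m)%N) ->
    componentwise_linear I) /\
  (* (h) *)
  (d_representable R d G ->
    (forall m : 'X_{1..n}, I 'X_[m] -> (d < mdeg m)%N) ->
    componentwise_linear I) /\
  (* (i) *)
  (chordal G -> forall W : {set 'I_n},
    componentwise_linear (SR_ideal K (on_vertices W (induced G W)))).
Proof.
move=> G; have [dG IE] := SR_complexK hI.
have part_linear : Leray K d.+1 (clique d.+1 G) ->
    squarefree_part I d.+1 = SR_ideal K (d_closure d G) /\
    linear_resolution d.+1 (squarefree_part I d.+1).
  move=> LG; rewrite d_closure_clique IE -/G; split; first exact: squarefree_part_clique.
  exact: linear_squarefree_part.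
have high_linear : Leray K d.+1 G -> (forall m : 'X_{1..n}, I 'X_[m] -> (d < mdeg m)%N) ->
    componentwise_linear I.
  move=> LG Id; rewrite IE; apply: componentwise_linear_SR => // j j2.
  have j0 : (0 < j)%N by apply: leq_trans j2.
  have [jd|dj] := leqP j d; last exact: Leray_clique (Leray_leq dj LG).
  apply: Leray_no_nonface => // H cH; apply: contraT => HG.
  have := Id (set_mnm H); rewrite IE mdeg_set_mnm cH ltnNge jd; apply.
  by apply/SR_ideal_X; rewrite ?supp_set_mnm.
have chordal_Leray : chordal G -> forall j, (2 <= j)%N -> Leray K j (clique j G).
  by move=> cG [|[|j]] // _; apply: Leray_chordal; apply: cG.
split; first by move=> cG; apply/part_linear/Leray_chordal.
split.
  move=> cG W; apply: linear_squarefree_part; first exact: on_vertices_down_closed.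
  exact/Leray_on_vertices/Leray_chordal.
split; first by move=> cG; apply/part_linear/Leray_clique => //; apply: Leray_collapsible.
split; first by move=> rG; apply/part_linear/Leray_clique => //; apply: Leray_representable rG.
split; first by move=> /chordal_Leray LG; rewrite IE; apply: componentwise_linear_SR.
split; last first.
  split; first by move=> cG; apply: high_linear; apply: Leray_collapsible.
  split; first by move=> rG; apply: high_linear; apply: Leray_representable rG.
  move=> cG W; apply: componentwise_linear_SR; first exact: on_vertices_down_closed.
  by move=> j j2; apply: Leray_on_vertices; apply: chordal_Leray.
move=> t s [_ tmin] [[ms msI msdeg] smax] cG.
have ts : (t <= s)%N by rewrite -msdeg; apply: tmin.
have nonface (F : {set 'I_n}) : F \notin G -> exists H : {set 'I_n},
    [/\ H \subset F, H \notin G & (t <= #|H| <= s)%N].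
  move=> FG; have [H [HF HG Hmin]] := minimal_generator_below K dG FG.
  by exists H; split=> //; rewrite -mdeg_set_mnm tmin ?smax // IE.
have mid j : (2 <= j)%N -> (t <= j <= s)%N -> Leray K j (clique j G).
  by case: j => [|[|j]] // _ /andP[tj js]; apply: Leray_chordal; apply: cG.
rewrite IE; apply: componentwise_linear_SR => // j j2.
have j0 : (0 < j)%N by apply: leq_trans j2.
have [jt|tj] := ltnP j t.
  apply: Leray_no_nonface => // H cH; apply: contraT => /nonface[H' [H'H _ /andP[tH' _]]].
  by have := leq_trans tH' (subset_leq_card H'H); rewrite cH leqNgt jt.
have [js|/ltnW sj] := leqP j s; first by apply: mid; rewrite ?tj.
apply: (Leray_clique_above (s := s)) => //.
  by move=> F /nonface[H [HF HG /andP[_ Hs]]]; exists H.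
case: s => [|[|s]] in smax ts mid nonface sj msdeg cG *.
- apply: Leray_clique0; have [+ _] := msI; rewrite {1}IE SR_ideal_X //.
  suff -> : supp ms = finset.set0 by [].
  apply: cards0_eq; apply/eqP; rewrite -leqn0 -msdeg; exact: card_supp.
- exact: Leray_clique1.
by apply: mid; rewrite // ts leqnn.
Qed.
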